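(* Consider problem $\min_{\mathbf x\in\mathbb R^n}F(\mathbf x)=\sum_{i=1}^I f_i(\mathbf x)$ where each $f_i$ is proper, closed and $L_i$-Lipschitz differentiable (possibly nonconvex) and $F$ is bounded from below. Let $\{(\mathbf x_i^k)_{i=1}^I\}_k$ be generated by ASY-SONATA (as in the context), where the step-size is obtained from a local sequence $\{\alpha^t\}_{t\in\mathbb N_0}$ with $\alpha^t\downarrow0$ and $\sum_t\alpha^t=\infty$ as follows: $\gamma^k=\alpha^{c_k}$, where $c_k$ is the number of iterations $t<k$ with $i^t=i^k$ (i.e., each agent draws successive elements of $\{\alpha^t\}$ according to its own activation count). For $\delta>0$ let $T_\delta$ be the first $k\in\mathbb N_0$ with $M_F(\mathbf x^k)\le\delta$. Then there is a constant $c>0$ such that $T_\delta\le\inf\{k\in\mathbb N_0:\sum_{t=0}^k\gamma^t\ge c/\delta\}$.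
   Context: Graph: $\mathcal G=(\mathcal V,\mathcal E)$, $\mathcal V=\{1,\dots,I\}$, strongly connected digraph without self-loops; $\mathcal N_i^{\rm in}=\{j:(j,i)\in\mathcal E\}$, $\mathcal N_i^{\rm out}=\{j:(i,j)\in\mathcal E\}$. Weight matrices $W=(w_{ij})$ (row-stochastic) and $A=(a_{ij})$ (column-stochastic) satisfy, for some $\bar m\in(0,1)$: diagonal entries $\ge\bar m$, entries $(i,j)$ with $(j,i)\in\mathcal E$ are $\ge\bar m$, all other entries $0$. Asynchrony model: $(i^k,\mathbf d^k)_{k\in\mathbb N_0}$, $i^k\in\mathcal V$, $\mathbf d^k=(d_j^k)_{j\in\mathcal N^{\rm in}_{i^k}}$, with every agent appearing among $i^k,\dots,i^{k+T-1}$ for all $k$ and $0\le d_j^k\le D$. ASY-SONATA: initialization $\mathbf x_i^0\in\mathbb R^n$, $\mathbf z_i^0=\nabla f_i(\mathbf x_i^0)$, $\tilde{\boldsymbol\rho}_{ij}^0=0$, $\tau_{ij}^{-1}=-D$, and $\boldsymbol\rho_{ij}^t=0$, $\mathbf v_i^t=0$ for $t=-D,\dots,0$. At iteration $k$ with $i=i^k$: (1) $\tau_{ij}^k=\max(\tau_{ij}^{k-1},k-d_j^k)$, $j\in\mathcal N_i^{\rm in}$; (2) $\mathbf v_i^{k+1}=\mathbf x_i^k-\gamma^k\mathbf z_i^k$; (3) $\mathbf x_i^{k+1}=w_{ii}\mathbf v_i^{k+1}+\sum_{j\in\mathcal N_i^{\rm in}}w_{ij}\mathbf v_j^{\tau_{ij}^k}$;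 (4) $\mathbf z_i^{k+1/2}=\mathbf z_i^k+\sum_{j\in\mathcal N_i^{\rm in}}(\boldsymbol\rho_{ij}^{\tau_{ij}^k}-\tilde{\boldsymbol\rho}_{ij}^k)+\nabla f_i(\mathbf x_i^{k+1})-\nabla f_i(\mathbf x_i^k)$; (5) $\mathbf z_i^{k+1}=a_{ii}\mathbf z_i^{k+1/2}$ and $\boldsymbol\rho_{ji}^{k+1}=\boldsymbol\rho_{ji}^k+a_{ji}\mathbf z_i^{k+1/2}$ for $j\in\mathcal N_i^{\rm out}$; (6) $\tilde{\boldsymbol\rho}_{ij}^{k+1}=\boldsymbol\rho_{ij}^{\tau_{ij}^k}$ for $j\in\mathcal N_i^{\rm in}$; (7) all other variables keep their values. Merit function: with $\mathbf x^k=[\mathbf x_1^{k\top},\dots,\mathbf x_I^{k\top}]^\top$ and $\bar{\mathbf x}^k=\frac1I\sum_i\mathbf x_i^k$, $M_F(\mathbf x^k)=\max\{\|\nabla F(\bar{\mathbf x}^k)\|^2,\|\mathbf x^k-\mathbf 1_I\otimes\bar{\mathbf x}^k\|^2\}$. *)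

(* Defs.v *)
From Stdlib Require Import Reals ZArith Relations Bool.
Open Scope R_scope.
Open Scope bool_scope.

(** Vectors of R^n are represented as functions [nat -> R]; only the
    coordinates [0..n-1] are ever observed (through [inner]/[norm]). *)
Definition vec := nat -> R.

Fixpoint rsum (m : nat) (f : nat -> R) : R :=
  match m with O => 0 | S m' => rsum m' f + f m' end.

Definition vzero : vec := fun _ => 0.
Definition vadd (u v : vec) : vec := fun l => u l + v l.
Definition vsub (u v : vec) : vec := fun l => u l - v l.
Definition vscale (a : R) (v : vec) : vec := fun l => a * v l.
Definition vsum (m : nat) (F : nat -> vec) : vec := fun l => rsum m (fun j => F j l).

Definition inner (n : nat) (u v : vec) : R := rsum n (fun l => u l * v l).
Definition sqnorm (n : nat) (v : vec) : R := inner n v v.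
Definition norm (n : nat) (v : vec) : R := sqrt (sqnorm n v).

Definition is_gradient (n : nat) (f : vec -> R) (g : vec -> vec) : Prop :=
  forall x eps, 0 < eps -> exists delta, 0 < delta /\
    forall h, norm n h < delta ->
      Rabs (f (vadd x h) - f x - inner n (g x) h) <= eps * norm n h.

(** State of ASY-SONATA at iteration k.
    sx a      = x_a^k,  sz a = z_a^k,  srt a j = rho~_{aj}^k,
    stau a j  = tau_{aj}^{k-1},
    sv t a    = v_a^t        (history, times t <= k; zero for t <= 0),
    srho t a b = rho_{ab}^t  (history, times t <= k; zero for t <= 0). *)
Record state := mkState {
  sx : nat -> vec;
  sz : nat -> vec;
  srt : nat -> nat -> vec;
  stau : nat -> nat -> Z;
  sv : Z -> nat -> vec;
  srho : Z -> nat -> nat -> vec }.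

Definition asy_init (D : nat) (g : nat -> vec -> vec) (x0 : nat -> vec) : state :=
  mkState x0 (fun i => g i (x0 i)) (fun _ _ => vzero) (fun _ _ => (- Z.of_nat D)%Z)
          (fun _ _ => vzero) (fun _ _ _ => vzero).

Definition asy_step (I : nat) (E : nat -> nat -> bool) (W A : nat -> nat -> R)
    (g : nat -> vec -> vec) (agent : nat -> nat) (d : nat -> nat -> nat)
    (gamma : nat -> R) (k : nat) (s : state) : state :=
  let i := agent k in
  let kz := Z.of_nat k in
  let tau' := fun a j => if Nat.eqb a i && E j i
                         then Z.max (stau s a j) (kz - Z.of_nat (d k j))%Z
                         else stau s a j in
  let vnew := vsub (sx s i) (vscale (gamma k) (sz s i)) in
  let xnew := vadd (vscale (W i i) vnew)
                   (vsum I (fun j => if E j i then vscale (W i j) (sv s (tau' i j) j)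
                                     else vzero)) in
  let zhalf := vadd (vadd (sz s i)
                          (vsum I (fun j => if E j i
                                            then vsub (srho s (tau' i j) i j) (srt s i j)
                                            else vzero)))
                    (vsub (g i xnew) (g i (sx s i))) in
  mkState
    (fun a => if Nat.eqb a i then xnew else sx s a)
    (fun a => if Nat.eqb a i then vscale (A i i) zhalf else sz s a)
    (fun a j => if Nat.eqb a i && E j i then srho s (tau' i j) i j else srt s a j)
    tau'
    (fun t a => if Z.eqb t (kz + 1)%Z
                then (if Nat.eqb a i then vnew else sv s kz a)
                else sv s t a)
    (fun t a b => if Z.eqb t (kz + 1)%Z
                  then (if Nat.eqb b i && E i a
                        then vadd (srho s kz a i) (vscale (A a i) zhalf)
                        else srho s kz a b)
                  else srho s t a b).

Fixpoint asy_run (I : nat) (E : nat -> nat -> bool) (W A : nat -> nat -> R)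
    (g : nat -> vec -> vec) (agent : nat -> nat) (d : nat -> nat -> nat)
    (gamma : nat -> R) (D : nat) (x0 : nat -> vec) (k : nat) : state :=
  match k with
  | O => asy_init D g x0
  | S k' => asy_step I E W A g agent d gamma k' (asy_run I E W A g agent d gamma D x0 k')
  end.

Fixpoint act_count (agent : nat -> nat) (k i : nat) : nat :=
  match k with
  | O => O
  | S k' => (act_count agent k' i + (if Nat.eqb (agent k') i then 1 else 0))%nat
  end.

Definition step_size (alpha : nat -> R) (agent : nat -> nat) (k : nat) : R :=
  alpha (act_count agent k (agent k)).

Definition xbar (I : nat) (x : nat -> vec) : vec := vscale (/ INR I) (vsum I x).

(** M_F(x) = max { ||grad F(xbar)||^2, ||x - 1 (x) xbar||^2 },
    grad F = sum_i grad f_i. *)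
Definition merit (n I : nat) (g : nat -> vec -> vec) (x : nat -> vec) : R :=
  let xb := xbar I x in
  Rmax (sqnorm n (vsum I (fun i => g i xb)))
       (rsum I (fun i => sqnorm n (vsub (x i) xb))).

(* Main.v *)
(** Coordinate by coordinate, the algorithm is a pair of linear systems with bounded
    delays, perturbed by the steps [gamma^k z] and by the gradient increments.

    The x-system is a delayed row-stochastic averaging. After a bounded time every value
    contains a fixed proportion of every other one, so the spread of the values contracts.
    The z-system redistributes mass (held by the agents or in transit) and conserves it.
    Since a fixed proportion of all mass reaches any given agent in bounded time, it
    contracts the l1 norm of states of total mass zero. Hence [z_i^k] is
    [xi_i^k * sum_j grad f_j (x_j^k)] up to an error [q_k], where [xi] is the trajectory
    started from the uniform distribution, while the spread of the x-system is at most
    [r_k]. Both bounds satisfy recursions of the form [r_(k+1) = rho r_k + c e_k].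

    For a horizon [K], let [y^k] be the value agent 0 would reach at time [K] if all steps
    from time [k] on were zero. Then [y^(k+1) = y^k - gamma^k beta z], with [beta] bounded
    away from 0 as long as [k] is not too close to [K]. Once the step sizes are small,
    [F (y^k) + a r_k^2 + q_k^2] decreases by at least a multiple of
    [gamma^k |grad F (y^k)|^2 + r_k^2]. Therefore [sum_k gamma^k M_F (x^k)] is bounded,
    which is the claim. Each error is weighted by the step size of its own iteration, so
    the step sizes of different agents are never compared. *)

Require Import Defs.
From Stdlib Require Import Reals ZArith Relations Bool Lra Lia Classical FunctionalExtensionality.
Open Scope R_scope.

(** * Finite sums *)

Lemma rsum_ext m f f' :
  (forall i, (i < m)%nat -> f i = f' i) -> rsum m f = rsum m f'.
Proof.
  induction m as [|m IH]; intros Hf; simpl; [reflexivity|].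
  rewrite IH by (intros; apply Hf; lia). rewrite Hf by lia. reflexivity.
Qed.

Lemma rsum_lin m a f b f' :
  rsum m (fun i => a * f i + b * f' i) = a * rsum m f + b * rsum m f'.
Proof. induction m as [|m IH]; simpl; [ring | rewrite IH; ring]. Qed.

Lemma rsum_plus m f f' : rsum m (fun i => f i + f' i) = rsum m f + rsum m f'.
Proof. induction m as [|m IH]; simpl; [ring | rewrite IH; ring]. Qed.

Lemma rsum_minus m f f' : rsum m (fun i => f i - f' i) = rsum m f - rsum m f'.
Proof. induction m as [|m IH]; simpl; [ring | rewrite IH; ring]. Qed.

Lemma rsum_scal m a f : rsum m (fun i => a * f i) = a * rsum m f.
Proof. induction m as [|m IH]; simpl; [ring | rewrite IH; ring]. Qed.

Lemma rsum_const m a : rsum m (fun _ => a) = INR m * a.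
Proof.
  induction m as [|m IH]; [simpl; ring|].
  rewrite S_INR; simpl; rewrite IH; ring.
Qed.

Lemma rsum_eq_0 m f : (forall i, (i < m)%nat -> f i = 0) -> rsum m f = 0.
Proof.
  intros Hf. rewrite (rsum_ext m f (fun _ => 0)) by assumption.
  rewrite rsum_const; ring.
Qed.

Lemma rsum_le m f f' :
  (forall i, (i < m)%nat -> f i <= f' i) -> rsum m f <= rsum m f'.
Proof.
  induction m as [|m IH]; intros Hf; simpl; [lra|].
  apply Rplus_le_compat; [apply IH; intros; apply Hf | apply Hf]; lia.
Qed.

Lemma rsum_nonneg m f : (forall i, (i < m)%nat -> 0 <= f i) -> 0 <= rsum m f.
Proof.
  intros Hf. rewrite <- (rsum_eq_0 m (fun _ => 0)) by auto. apply rsum_le; auto.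
Qed.

Lemma rsum_term_le m f i :
  (forall j, (j < m)%nat -> 0 <= f j) -> (i < m)%nat -> f i <= rsum m f.
Proof.
  induction m as [|m IH]; intros Hf Hi; [lia|]; simpl.
  destruct (Nat.eq_dec i m) as [->|].
  - pose proof (rsum_nonneg m f ltac:(intros; apply Hf; lia)); lra.
  - specialize (IH ltac:(intros; apply Hf; lia) ltac:(lia)).
    pose proof (Hf m ltac:(lia)); lra.
Qed.

Lemma rsum_abs m f : Rabs (rsum m f) <= rsum m (fun i => Rabs (f i)).
Proof.
  induction m as [|m IH]; simpl; [rewrite Rabs_R0; lra|].
  eapply Rle_trans; [apply Rabs_triang | lra].
Qed.

Lemma rsum_single m i c :
  (i < m)%nat -> rsum m (fun a => if Nat.eqb a i then c else 0) = c.
Proof.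
  induction m as [|m IH]; intros Hi; [lia|]; simpl.
  destruct (Nat.eqb_spec m i) as [->|Hne].
  - rewrite rsum_eq_0; [ring|].
    intros j Hj. destruct (Nat.eqb_spec j i); [lia|reflexivity].
  - rewrite IH by lia; ring.
Qed.

Lemma rsum_exchange m p f :
  rsum m (fun i => rsum p (fun j => f i j)) = rsum p (fun j => rsum m (fun i => f i j)).
Proof.
  induction m as [|m IH]; simpl.
  - symmetry; apply rsum_eq_0; auto.
  - rewrite IH, <- rsum_plus. reflexivity.
Qed.

Lemma rsum_split m p f : rsum (m + p) f = rsum m f + rsum p (fun i => f (m + i)%nat).
Proof.
  induction p as [|p IH]; [rewrite Nat.add_0_r; simpl; ring|].
  rewrite Nat.add_succ_r; simpl; rewrite IH; ring.
Qed.

(** * Iterated time-varying maps *)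

Fixpoint evolve {H : Type} (step : nat -> H -> H) (k m : nat) (h : H) : H :=
  match m with O => h | S m' => step (k + m')%nat (evolve step k m' h) end.

Lemma evolve_add {H} (step : nat -> H -> H) k m m' h :
  evolve step k (m + m') h = evolve step (k + m) m' (evolve step k m h).
Proof.
  induction m' as [|m' IH]; [rewrite Nat.add_0_r; reflexivity|].
  rewrite Nat.add_succ_r; simpl. rewrite IH, Nat.add_assoc. reflexivity.
Qed.

Lemma evolve_S_front {H} (step : nat -> H -> H) k m h :
  evolve step k (S m) h = evolve step (S k) m (step k h).
Proof.
  change (S m) with (1 + m)%nat. rewrite evolve_add. simpl.
  rewrite Nat.add_0_r, Nat.add_1_r. reflexivity.
Qed.

Lemma bernoulli eta m : 0 <= eta <= 1 -> 1 - INR m * eta <= (1 - eta) ^ m.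
Proof.
  intros He. induction m as [|m IH]; [simpl; lra|].
  rewrite S_INR; simpl.
  assert (0 <= INR m * eta * eta) by (repeat apply Rmult_le_pos; try apply pos_INR; lra).
  apply Rle_trans with ((1 - eta) * (1 - INR m * eta)); [nra|].
  apply Rmult_le_compat_l; lra.
Qed.

(** Bernoulli's inequality makes [1 - eta / B] an explicit substitute for the [B]-th root of
    [1 - eta]: a contraction once in [B] steps becomes a rate per step. *)
Lemma root_rate eta B :
  0 < eta < 1 -> (0 < B)%nat -> exists rho, 0 < rho < 1 /\ 1 - eta <= rho ^ B.
Proof.
  intros He HB. exists (1 - eta / INR B).
  assert (HB1 : 1 <= INR B) by (change 1 with (INR 1); apply le_INR; lia).
  assert (H : eta / INR B * INR B = eta) by (field; lra).
  assert (0 < eta / INR B) by (apply Rdiv_lt_0_compat; lra).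
  assert (eta / INR B < 1) by nra.
  split; [lra|].
  pose proof (bernoulli (eta / INR B) B ltac:(lra)); lra.
Qed.

(** One coordinate of a system with memory: the agents' current values and a doubly indexed record.
    Averaging indexes the record by time, then agent; mass splitting by receiver, then time. *)
Definition hstate : Type := ((nat -> R) * (nat -> nat -> R))%type.

Definition hlin (a : R) (h : hstate) (b : R) (h' : hstate) : hstate :=
  (fun i => a * fst h i + b * fst h' i, fun s t => a * snd h s t + b * snd h' s t).

Lemma evolve_hlin step :
  (forall k a h b h', step k (hlin a h b h') = hlin a (step k h) b (step k h')) ->
  forall k m a h b h',
    evolve step k m (hlin a h b h') = hlin a (evolve step k m h) b (evolve step k m h').
Proof.
  intros Hlin k m a h b h'. induction m as [|m IH]; simpl; [reflexivity|].
  rewrite IH. apply Hlin.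
Qed.

(** * Geometric envelopes for perturbed linear systems contracting every [B] steps *)

Section Envelope.

Variables (step : nat -> hstate -> hstate) (Bd : nat -> hstate -> R -> Prop).
Variables (eta : R) (B : nat).
Hypothesis Heta : 0 < eta < 1.
Hypothesis HB : (0 < B)%nat.
Hypothesis step_lin :
  forall k a h b h', step k (hlin a h b h') = hlin a (step k h) b (step k h').
Hypothesis Bd_mono : forall k h r r', r <= r' -> Bd k h r -> Bd k h r'.
Hypothesis Bd_add :
  forall k h h' r r', Bd k h r -> Bd k h' r' -> Bd k (hlin 1 h 1 h') (r + r').
Hypothesis Bd_step : forall k h r, Bd k h r -> Bd (S k) (step k h) r.
Hypothesis Bd_contr :
  forall k h r, 0 <= r -> Bd k h r -> Bd (k + B)%nat (evolve step k B h) ((1 - eta) * r).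

Lemma Bd_iter k m h r : Bd k h r -> Bd (k + m)%nat (evolve step k m h) r.
Proof.
  intros Hb. induction m as [|m IH]; simpl; [rewrite Nat.add_0_r; exact Hb|].
  rewrite Nat.add_succ_r. apply Bd_step, IH.
Qed.

(** Strong induction removes blocks of [B] steps, each worth a factor [1 - eta <= rho ^ B]. An
    incomplete block yields no contraction, which the constant [/ rho ^ B] pays for. *)
Lemma Bd_geometric rho :
  0 < rho < 1 -> 1 - eta <= rho ^ B ->
  forall m k h r, 0 <= r -> Bd k h r ->
    Bd (k + m)%nat (evolve step k m h) (rho ^ m * (/ rho ^ B * r)).
Proof.
  intros Hrho HrhoB m.
  assert (HpB : 0 < rho ^ B) by (apply pow_lt; lra).
  induction m as [m IH] using lt_wf_ind. intros k h r Hr Hb.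
  destruct (le_lt_dec B m) as [HBm|HBm].
  - replace m with (B + (m - B))%nat at 1 2 by lia.
    rewrite evolve_add, Nat.add_assoc.
    assert (Hr' : 0 <= (1 - eta) * r) by (apply Rmult_le_pos; lra).
    specialize (IH (m - B)%nat ltac:(lia) _ _ _ Hr' (Bd_contr _ _ _ Hr Hb)).
    eapply Bd_mono; [|exact IH].
    replace (rho ^ m) with (rho ^ (m - B) * rho ^ B) by (rewrite <- pow_add; f_equal; lia).
    rewrite Rmult_assoc. apply Rmult_le_compat_l; [apply pow_le; lra|].
    replace (rho ^ B * (/ rho ^ B * r)) with (/ rho ^ B * (rho ^ B * r)) by ring.
    apply Rmult_le_compat_l; [apply Rlt_le, Rinv_0_lt_compat; lra|].
    apply Rmult_le_compat_r; lra.
  - eapply Bd_mono; [|apply Bd_iter, Hb].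
    replace B with (m + (B - m))%nat by lia. rewrite pow_add.
    assert (Hp1 : 0 < rho ^ m) by (apply pow_lt; lra).
    assert (Hp2 : 0 < rho ^ (B - m)) by (apply pow_lt; lra).
    replace (rho ^ m * (/ (rho ^ m * rho ^ (B - m)) * r)) with (/ rho ^ (B - m) * r)
      by (field; lra).
    rewrite <- (Rmult_1_l r) at 1. apply Rmult_le_compat_r; [lra|].
    rewrite <- Rinv_1. apply Rinv_le_contravar; [lra|].
    replace 1 with (1 ^ (B - m)) by apply pow1. apply pow_incr; lra.
Qed.

(* The bounds [forall m, Bd (k + m) (evolve k m h) (rho ^ m * r)] play the role of an
   adapted norm: one step contracts them by [rho], so that perturbations of a
   trajectory simply add up. *)
Lemma envelope : exists rho c, 0 < rho < 1 /\ 0 < c /\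
  forall (h w : nat -> hstate) (r0 : R) (e r : nat -> R),
    0 <= r0 -> Bd 0 (h O) r0 ->
    (forall k, 0 <= e k) ->
    (forall k, h (S k) = hlin 1 (step k (h k)) 1 (w k)) ->
    (forall k, Bd (S k) (w k) (e k)) ->
    r O = c * r0 -> (forall k, r (S k) = rho * r k + c * e k) ->
    forall k, Bd k (h k) (r k).
Proof.
  destruct (root_rate eta B Heta HB) as (rho & Hrho & HrhoB).
  assert (HpB : 0 < rho ^ B) by (apply pow_lt; lra).
  exists rho, (/ rho ^ B). split; [exact Hrho|]. split; [apply Rinv_0_lt_compat; lra|].
  intros h w r0 e r Hr0 Hh0 He Hh Hw Hr0' Hr.
  assert (Hstrong : forall k m, Bd (k + m)%nat (evolve step k m (h k)) (rho ^ m * r k)).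
  { induction k as [|k IH]; intros m.
    - rewrite Hr0'. apply Bd_geometric; assumption.
    - rewrite Hh, Hr, evolve_hlin by exact step_lin.
      rewrite Rmult_plus_distr_l. apply Bd_add.
      + rewrite <- evolve_S_front, Nat.add_succ_comm.
        eapply Bd_mono; [|apply IH]. simpl; lra.
      + apply Bd_geometric; auto. }
  intros k. specialize (Hstrong k O). simpl in Hstrong.
  rewrite Nat.add_0_r, Rmult_1_l in Hstrong. exact Hstrong.
Qed.

End Envelope.

(** * Strong connectivity *)

(** [Rch N j i] stands for a quantified influence of [j] on [i] after [N] steps. Influences compose
    along paths and survive waiting, so the path lengths of the finitely many pairs can be padded to
    one common [N]. Both linear systems use this. *)
Lemma uniform_reach (V : nat) (E : nat -> nat -> bool) (Rch : nat -> nat -> nat -> Prop) N0 :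
  (forall i j, E i j = true -> (i < V)%nat /\ (j < V)%nat) ->
  (forall i j, (i < V)%nat -> (j < V)%nat ->
     clos_refl_trans nat (fun a b => E a b = true) i j) ->
  (forall j, (j < V)%nat -> Rch O j j) ->
  (forall N j i, (j < V)%nat -> (i < V)%nat -> Rch N j i -> Rch (S N) j i) ->
  (forall N M j i l, (j < V)%nat -> (i < V)%nat -> (l < V)%nat ->
     Rch N j i -> Rch M i l -> Rch (N + M)%nat j l) ->
  (forall j i, E j i = true -> Rch N0 j i) ->
  exists N, forall j i, (j < V)%nat -> (i < V)%nat -> Rch N j i.
Proof.
  intros HEV Hconn Hrefl HS Htrans Hedge.
  assert (Hle : forall N M j i, (j < V)%nat -> (i < V)%nat -> (N <= M)%nat ->
                  Rch N j i -> Rch M j i).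
  { intros N M j i Hj Hi HNM HN. induction HNM; auto. }
  assert (Hex : forall j i, (j < V)%nat -> (i < V)%nat -> exists N, Rch N j i).
  { intros j i Hj Hi.
    assert (Hji := clos_rt_rt1n _ _ _ _ (Hconn j i Hj Hi)).
    clear Hi. induction Hji as [j|j l i Hjl Hli IH]; [eauto|].
    destruct (HEV _ _ Hjl) as [_ Hl]. destruct (IH Hl) as [N HN].
    assert (Hi : (i < V)%nat).
    { clear IH HN N Hedge. revert Hl. clear Hjl Hj.
      induction Hli as [|a b c Hab Hbc IH]; auto.
      intros _. apply IH. apply (HEV _ _ Hab). }
    exists (N0 + N)%nat. eauto. }
  assert (Hrow : forall j, (j < V)%nat -> forall p, (p <= V)%nat ->
            exists N, forall i, (i < p)%nat -> Rch N j i).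
  { intros j Hj p. induction p as [|p IH]; intros Hp; [exists O; lia|].
    destruct (IH ltac:(lia)) as [N1 HN1]. destruct (Hex j p Hj ltac:(lia)) as [N2 HN2].
    exists (N1 + N2)%nat. intros i Hi. destruct (Nat.eq_dec i p) as [->|].
    - apply (Hle N2); auto; lia.
    - apply (Hle N1); try lia. apply HN1; lia. }
  assert (Hall : forall p, (p <= V)%nat ->
            exists N, forall j i, (j < p)%nat -> (i < V)%nat -> Rch N j i).
  { induction p as [|p IH]; intros Hp; [exists O; lia|].
    destruct (IH ltac:(lia)) as [N1 HN1].
    destruct (Hrow p ltac:(lia) V ltac:(lia)) as [N2 HN2].
    exists (N1 + N2)%nat. intros j i Hj Hi. destruct (Nat.eq_dec j p) as [->|].
    - apply (Hle N2); auto; lia.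
    - apply (Hle N1); try lia. apply HN1; lia. }
  exact (Hall V (Nat.le_refl V)).
Qed.

Lemma hstate_ext (h h' : hstate) :
  (forall a, fst h a = fst h' a) -> (forall s t, snd h s t = snd h' s t) -> h = h'.
Proof.
  destruct h as [x v], h' as [x' v']; simpl; intros Hx Hv. f_equal.
  - apply functional_extensionality; exact Hx.
  - apply functional_extensionality; intros s.
    apply functional_extensionality; intros t; apply Hv.
Qed.

Lemma pow_unit_le x m p : 0 < x < 1 -> (m <= p)%nat -> x ^ p <= x ^ m.
Proof.
  intros Hx Hmp. induction Hmp as [|p Hmp IH]; [lra|].
  simpl. assert (0 < x ^ p) by (apply pow_lt; lra). nra.
Qed.

(** * Delayed averaging *)

Section Averaging.

Variables (V T D : nat) (E : nat -> nat -> bool) (W : nat -> nat -> R) (mbar : R).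
Variables (agent : nat -> nat) (src : nat -> nat -> nat).
Hypothesis HEV : forall i j, E i j = true -> (i < V)%nat /\ (j < V)%nat.
Hypothesis HEloop : forall i, E i i = false.
Hypothesis HEconn : forall i j, (i < V)%nat -> (j < V)%nat ->
  clos_refl_trans nat (fun a b => E a b = true) i j.
Hypothesis Hm : 0 < mbar < 1.
Hypothesis HWd : forall i, (i < V)%nat -> mbar <= W i i.
Hypothesis HWe : forall i j, (i < V)%nat -> (j < V)%nat -> E j i = true -> mbar <= W i j.
Hypothesis HW0 : forall i j,
  (i < V)%nat -> (j < V)%nat -> i <> j -> E j i = false -> W i j = 0.
Hypothesis HWrow : forall i, (i < V)%nat -> rsum V (fun j => W i j) = 1.
Hypothesis Hagent : forall k, (agent k < V)%nat.
Hypothesis HT : forall k i, (i < V)%nat -> exists t, (k <= t < k + T)%nat /\ agent t = i.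
Hypothesis Hsrc : forall k j, E j (agent k) = true -> (k - D <= src k j <= k)%nat.

(* [snd h t a] is the value published by [a] at the absolute time [t]. *)
Definition avg_step (k : nat) (h : hstate) : hstate :=
  let i := agent k in
  (fun a => if Nat.eqb a i
            then W i i * fst h i
                 + rsum V (fun j => if E j i then W i j * snd h (src k j) j else 0)
            else fst h a,
   fun t a => if Nat.eqb t (S k) then (if Nat.eqb a i then fst h i else snd h k a)
              else snd h t a).

(** Only the last [D + 1] record times are constrained: a read at time [k] reaches no further
    back. *)
Definition avg_low (k : nat) (h : hstate) (m : R) : Prop :=
  (forall a, (a < V)%nat -> m <= fst h a) /\
  (forall t a, (a < V)%nat -> (k - D <= t <= k)%nat -> m <= snd h t a).

(** The upper bound [m + r] is phrased as a lower bound of the negated state, so that all estimates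
    need proof for lower bounds only. *)
Definition avg_spread (k : nat) (h : hstate) (r : R) : Prop :=
  exists m, avg_low k h m /\ avg_low k (hlin (-1) h 0 h) (- (m + r)).

(** The consensus state, a fixed point by row-stochasticity. Subtracting multiples of it reduces any
    lower bound to the bound 0. *)
Definition hone : hstate := (fun _ => 1, fun _ _ => 1).

Lemma avg_step_lin k a h b h' :
  avg_step k (hlin a h b h') = hlin a (avg_step k h) b (avg_step k h').
Proof.
  apply hstate_ext; unfold avg_step; simpl.
  - intros c. destruct (Nat.eqb c (agent k)); [|reflexivity].
    rewrite (rsum_ext V _ (fun j =>
      a * (if E j (agent k) then W (agent k) j * snd h (src k j) j else 0)
      + b * (if E j (agent k) then W (agent k) j * snd h' (src k j) j else 0))).
    + rewrite rsum_lin. ring.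
    + intros j _. destruct (E j (agent k)); ring.
  - intros t c. destruct (Nat.eqb t (S k)), (Nat.eqb c (agent k)); reflexivity.
Qed.

Lemma row_weights i : (i < V)%nat ->
  W i i + rsum V (fun j => if E j i then W i j else 0) = 1.
Proof.
  intros Hi. rewrite <- (HWrow i Hi).
  rewrite <- (rsum_single V i (W i i) Hi) at 1. rewrite <- rsum_plus.
  apply rsum_ext. intros j Hj. destruct (Nat.eqb_spec j i) as [->|Hne].
  - rewrite HEloop. ring.
  - destruct (E j i) eqn:He; [ring|]. rewrite HW0 by auto. ring.
Qed.

Lemma avg_step_hone k : avg_step k hone = hone.
Proof.
  apply hstate_ext; unfold avg_step; simpl.
  - intros c. destruct (Nat.eqb c (agent k)); [|reflexivity].
    rewrite Rmult_1_r, <- (row_weights (agent k)) at 1 by apply Hagent.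
    f_equal. apply rsum_ext. intros j _. destruct (E j (agent k)); ring.
  - intros t c. destruct (Nat.eqb t (S k)), (Nat.eqb c (agent k)); reflexivity.
Qed.

Lemma avg_iter_hone k m : evolve avg_step k m hone = hone.
Proof.
  induction m as [|m IH]; simpl; [reflexivity|]. rewrite IH. apply avg_step_hone.
Qed.

Lemma avg_low_step k h m : avg_low k h m -> avg_low (S k) (avg_step k h) m.
Proof.
  intros [Hx Hv]. split; unfold avg_step; cbn [fst snd].
  - intros a Ha. destruct (Nat.eqb a (agent k)); [|auto].
    rewrite <- (Rmult_1_l m), <- (row_weights (agent k) (Hagent k)), Rmult_plus_distr_r.
    apply Rplus_le_compat.
    + apply Rmult_le_compat_l; [pose proof (HWd _ (Hagent k)); lra | auto].
    + rewrite (Rmult_comm _ m), <- rsum_scal. apply rsum_le. intros j Hj.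
      destruct (E j (agent k)) eqn:He; [|lra]. rewrite Rmult_comm.
      apply Rmult_le_compat_l.
      * pose proof (HWe _ _ (Hagent k) Hj He); lra.
      * apply Hv; auto.
  - intros t a Ha Ht. destruct (Nat.eqb_spec t (S k)).
    + destruct (Nat.eqb a (agent k)); auto. apply Hv; auto; lia.
    + apply Hv; auto; lia.
Qed.

Lemma avg_low_iter k h m s : avg_low k h m -> avg_low (k + s) (evolve avg_step k s h) m.
Proof.
  intros Hl. induction s as [|s IH]; simpl; [rewrite Nat.add_0_r; exact Hl|].
  rewrite Nat.add_succ_r. apply avg_low_step, IH.
Qed.

Lemma avg_low_shift k h m c :
  avg_low k (hlin 1 h (- m) hone) c <-> avg_low k h (m + c).
Proof.
  unfold avg_low; simpl. split; intros [Hx Hv]; split; intros.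
  - specialize (Hx a H); lra.
  - specialize (Hv t a H H0); lra.
  - specialize (Hx a H); lra.
  - specialize (Hv t a H H0); lra.
Qed.

(** An active agent keeps at least the self weight [mbar] of its value and adds nonnegative terms;
    an inactive one keeps everything. *)
Lemma avg_decay k s h a : avg_low k h 0 -> (a < V)%nat ->
  mbar ^ s * fst h a <= fst (evolve avg_step k s h) a.
Proof.
  intros Hl Ha. induction s as [|s IH]; [simpl; lra|].
  pose proof (avg_low_iter k h 0 s Hl) as [Hx Hv].
  apply Rle_trans with (mbar * fst (evolve avg_step k s h) a).
  { simpl. rewrite Rmult_assoc. apply Rmult_le_compat_l; lra. }
  simpl. destruct (Nat.eqb_spec a (agent (k + s))) as [He|He].
  - rewrite <- He.
    assert (0 <= rsum V (fun j => if E j a then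
              W a j * snd (evolve avg_step k s h) (src (k + s) j) j else 0)).
    { apply rsum_nonneg. intros j Hj. destruct (E j a) eqn:Hja; [|lra].
      apply Rmult_le_pos.
      - pose proof (HWe _ _ Ha Hj Hja); lra.
      - apply Hv; auto. apply Hsrc. rewrite <- He; exact Hja. }
    pose proof (HWd _ Ha). specialize (Hx a Ha). nra.
  - specialize (Hx a Ha). nra.
Qed.

(** From its activation at [k + s0] on, [j] only publishes values it held at time [k] or later, or
    repeats such a publication; the unknown older record has been overwritten. *)
Lemma avg_publish k s0 s t h j : avg_low k h 0 -> (j < V)%nat -> agent (k + s0) = j ->
  (k + s0 < t <= k + s)%nat ->
  mbar ^ s * fst h j <= snd (evolve avg_step k s h) t j.
Proof.
  intros Hl Hj Hs0. revert t.
  assert (Hhj : 0 <= fst h j) by (apply Hl; exact Hj).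
  induction s as [|s IH]; intros t Ht; [lia|].
  assert (Hmon : mbar ^ S s * fst h j <= mbar ^ s * fst h j).
  { apply Rmult_le_compat_r; [exact Hhj|]. apply pow_unit_le; auto. }
  simpl evolve; unfold avg_step at 1; simpl snd.
  destruct (Nat.eqb_spec t (S (k + s))) as [->|Hne].
  - destruct (Nat.eqb_spec j (agent (k + s))) as [He|He].
    + eapply Rle_trans; [exact Hmon|]. rewrite <- He. apply avg_decay; assumption.
    (* The entry copied here is the one of time [k + s], which is already later than the activation
       [k + s0]. *)
    + assert (s <> s0) by (intros ->; congruence).
      eapply Rle_trans; [exact Hmon|]. apply IH; lia.
  - eapply Rle_trans; [exact Hmon|]. apply IH; lia.
Qed.

Definition avg_reach (N j i : nat) : Prop := forall k h, avg_low k h 0 ->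
  mbar ^ N * fst h j <= fst (evolve avg_step k N h) i.

(** [j] publishes before [k + T]. An activation of [i] at or after [k + T + D] then reads, even with
    delay [D], something published after that. Such an activation occurs before [k + 2 * T + D], and
    [avg_decay] bridges the remaining steps. *)
Lemma avg_reach_edge j i : E j i = true -> avg_reach (2 * T + D + 1) j i.
Proof.
  intros He k h Hl. destruct (HEV _ _ He) as [Hj Hi].
  destruct (HT k j Hj) as (t0 & Ht0 & Hat0).
  destruct (HT (k + T + D) i Hi) as (t1 & Ht1 & Hat1).
  replace t0 with (k + (t0 - k))%nat in Hat0 by lia.
  set (s1 := (t1 - k)%nat). assert (Ets : t1 = (k + s1)%nat) by (unfold s1; lia).
  rewrite Ets in Hat1. subst i.
  pose proof (Hsrc _ _ He) as Hs.
  assert (Hx : mbar ^ S s1 * fst h j <= fst (evolve avg_step k (S s1) h) (agent (k + s1))).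
  { pose proof (avg_publish k (t0 - k) s1 (src (k + s1) j) h j Hl Hj Hat0 ltac:(lia)) as Hp.
    pose proof (avg_low_iter k h 0 s1 Hl) as [Hx Hv].
    simpl. rewrite Nat.eqb_refl.
    pose proof (rsum_term_le V (fun j0 => if E j0 (agent (k + s1)) then
       W (agent (k + s1)) j0 * snd (evolve avg_step k s1 h) (src (k + s1) j0) j0 else 0) j)
      as Hterm. simpl in Hterm. rewrite He in Hterm.
    assert (Hnn : forall j0, (j0 < V)%nat -> 0 <= if E j0 (agent (k + s1)) then
       W (agent (k + s1)) j0 * snd (evolve avg_step k s1 h) (src (k + s1) j0) j0 else 0).
    { intros j0 Hj0. destruct (E j0 (agent (k + s1))) eqn:He0; [|lra].
      apply Rmult_le_pos; [pose proof (HWe _ _ Hi Hj0 He0); lra|].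
      apply Hv; auto. }
    specialize (Hterm Hnn Hj).
    pose proof (HWe _ _ Hi Hj He). pose proof (HWd _ Hi).
    specialize (Hx _ Hi). assert (0 <= fst h j) by (apply Hl; exact Hj).
    assert (0 <= mbar ^ s1 * fst h j) by (apply Rmult_le_pos; [apply pow_le|]; lra).
    assert (0 <= W (agent (k + s1)) (agent (k + s1))
                 * fst (evolve avg_step k s1 h) (agent (k + s1)))
      by (apply Rmult_le_pos; lra).
    assert (mbar * (mbar ^ s1 * fst h j)
            <= W (agent (k + s1)) j * snd (evolve avg_step k s1 h) (src (k + s1) j) j)
      by (apply Rmult_le_compat; lra).
    lra. }
  replace (2 * T + D + 1)%nat with (S s1 + (2 * T + D - s1))%nat by lia.
  rewrite evolve_add, pow_add.
  eapply Rle_trans; [|apply avg_decay; [apply avg_low_iter; exact Hl | exact Hi]].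
  rewrite (Rmult_comm (mbar ^ S s1)), Rmult_assoc.
  apply Rmult_le_compat_l; [apply pow_le; lra | exact Hx].
Qed.

Lemma avg_positivity : exists N, (0 < N)%nat /\ forall k h j, (j < V)%nat ->
  avg_low k h 0 -> avg_low (k + N) (evolve avg_step k N h) (mbar ^ N * fst h j).
Proof.
  destruct (uniform_reach V E avg_reach (2 * T + D + 1) HEV HEconn) as [N HN].
  - intros j Hj k h Hl. simpl. lra.
  - intros N j i Hj Hi HN k h Hl. specialize (HN k h Hl).
    rewrite <- (Nat.add_1_r N), evolve_add.
    eapply Rle_trans; [|apply avg_decay; [apply avg_low_iter; exact Hl | exact Hi]].
    rewrite pow_add, Rmult_assoc, (Rmult_comm (mbar ^ N)), Rmult_assoc.
    apply Rmult_le_compat_l; [apply pow_le; lra|]. lra.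
  - intros N M j i l Hj Hi Hl' HN HM k h Hl.
    rewrite evolve_add. eapply Rle_trans; [|apply HM, avg_low_iter; exact Hl].
    rewrite pow_add, (Rmult_comm (mbar ^ N)), Rmult_assoc.
    apply Rmult_le_compat_l; [apply pow_le; lra | apply HN; exact Hl].
  - intros j i He. apply avg_reach_edge; exact He.
  (* After [N] steps every current value is large; [T] more let every agent publish, and [D] more
     push all earlier entries out of the window. *)
  - exists (N + (T + D))%nat. split.
    + destruct (HT 0 (agent 0) (Hagent 0)) as (t & Ht & _). lia.
    + intros k h j Hj Hl. rewrite evolve_add, pow_add, Nat.add_assoc.
      assert (HlN := avg_low_iter k h 0 N Hl).
      assert (Hc : forall i, (i < V)%nat -> mbar ^ N * mbar ^ (T + D) * fst h j
                     <= mbar ^ (T + D) * fst (evolve avg_step k N h) i).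
      { intros i Hi. rewrite (Rmult_comm (mbar ^ N)), Rmult_assoc.
        apply Rmult_le_compat_l; [apply pow_le; lra | apply HN; auto]. }
      split.
      * intros i Hi. eapply Rle_trans; [apply (Hc i Hi)|]. apply avg_decay; auto.
      * intros t i Hi Ht. eapply Rle_trans; [apply (Hc i Hi)|].
        destruct (HT (k + N) i Hi) as (t0 & Ht0 & Hat0).
        apply (avg_publish _ (t0 - (k + N))%nat); auto; [|lia].
        rewrite <- Hat0. f_equal; lia.
Qed.

Lemma avg_low_shift_iter N : (forall k h j, (j < V)%nat ->
    avg_low k h 0 -> avg_low (k + N) (evolve avg_step k N h) (mbar ^ N * fst h j)) ->
  forall k h j m, (j < V)%nat -> avg_low k h m ->
    avg_low (k + N) (evolve avg_step k N h) (m + mbar ^ N * (fst h j - m)).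
Proof.
  intros HN k h j m Hj Hl.
  assert (Hl0 : avg_low k (hlin 1 h (- m) hone) 0)
    by (apply avg_low_shift; rewrite Rplus_0_r; exact Hl).
  specialize (HN _ _ _ Hj Hl0).
  rewrite evolve_hlin in HN by exact avg_step_lin. rewrite avg_iter_hone in HN.
  apply avg_low_shift in HN. simpl in HN.
  replace (1 * fst h j + - m * 1) with (fst h j - m) in HN by ring. exact HN.
Qed.

Lemma avg_envelope : (0 < V)%nat -> exists rho c, 0 < rho < 1 /\ 0 < c /\
  forall (h w : nat -> hstate) (r0 : R) (e r : nat -> R),
    0 <= r0 -> avg_spread 0 (h O) r0 ->
    (forall k, 0 <= e k) ->
    (forall k, h (S k) = hlin 1 (avg_step k (h k)) 1 (w k)) ->
    (forall k, avg_spread (S k) (w k) (e k)) ->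
    r O = c * r0 -> (forall k, r (S k) = rho * r k + c * e k) ->
    forall k, avg_spread k (h k) (r k).
Proof.
  intros HV. destruct avg_positivity as (N & HN0 & HN).
  apply (envelope avg_step avg_spread (mbar ^ N) N); auto.
  - split; [apply pow_lt; lra|].
    apply Rle_lt_trans with (mbar ^ 1); [apply pow_unit_le; auto; lia | simpl; lra].
  - apply avg_step_lin.
  - intros k h r r' Hr (m & Hlo & Hx & Hv). exists m. split; [exact Hlo|]. split; intros.
    + specialize (Hx a H); lra.
    + specialize (Hv t a H H0); lra.
  - intros k h h' r r' (m & [Hlx Hlv] & Hux & Huv) (m' & [Hlx' Hlv'] & Hux' & Huv').
    simpl in *. exists (m + m'). split; split; simpl; intros.
    + specialize (Hlx a H); specialize (Hlx' a H); lra.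
    + specialize (Hlv t a H H0); specialize (Hlv' t a H H0); lra.
    + specialize (Hux a H); specialize (Hux' a H); lra.
    + specialize (Huv t a H H0); specialize (Huv' t a H H0); lra.
  - intros k h r (m & Hlo & Hup). exists m. split; [apply avg_low_step; exact Hlo|].
    rewrite <- avg_step_lin. apply avg_low_step; exact Hup.
  (* With [x] the value of agent 0, the lower end rises by [mbar ^ N * (x - m)] and the upper end
     falls by [mbar ^ N * (m + r - x)]. These add up to [mbar ^ N * r], whatever [x] is. *)
  - intros k h r Hr (m & Hlo & Hup). exists (m + mbar ^ N * (fst h O - m)). split.
    + apply avg_low_shift_iter; auto.
    + rewrite <- evolve_hlin by exact avg_step_lin.
      pose proof (avg_low_shift_iter N HN _ _ O _ HV Hup) as Hup'. simpl in Hup'.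
      replace (- (m + mbar ^ N * (fst h O - m) + (1 - mbar ^ N) * r)) with
        (- (m + r) + mbar ^ N * (-1 * fst h O + 0 * fst h O - - (m + r))) by ring.
      exact Hup'.
Qed.

End Averaging.

(** * Delayed mass splitting *)

Section MassSplitting.

Variables (V T D : nat) (E : nat -> nat -> bool) (A : nat -> nat -> R) (mbar : R).
Variables (agent : nat -> nat) (rcv : nat -> nat -> bool).
Hypothesis HV : (0 < V)%nat.
Hypothesis HEV : forall i j, E i j = true -> (i < V)%nat /\ (j < V)%nat.
Hypothesis HEloop : forall i, E i i = false.
Hypothesis HEconn : forall i j, (i < V)%nat -> (j < V)%nat ->
  clos_refl_trans nat (fun a b => E a b = true) i j.
Hypothesis Hm : 0 < mbar < 1.
Hypothesis HAd : forall i, (i < V)%nat -> mbar <= A i i.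
Hypothesis HAe : forall i j, (i < V)%nat -> (j < V)%nat -> E j i = true -> mbar <= A i j.
Hypothesis HA0 : forall i j,
  (i < V)%nat -> (j < V)%nat -> i <> j -> E j i = false -> A i j = 0.
Hypothesis HAcol : forall j, (j < V)%nat -> rsum V (fun i => A i j) = 1.
Hypothesis Hagent : forall k, (agent k < V)%nat.
Hypothesis HT : forall k i, (i < V)%nat -> exists t, (k <= t < k + T)%nat /\ agent t = i.
Hypothesis Hrcv : forall k t, (t + D < k)%nat -> rcv k t = true.

(* [snd h a t] is the mass sent to [a] at time [t] and not yet received;
   [rcv k t] tells whether the agent active at time [k] receives what was sent at time [t]. *)
Definition split_half (k : nat) (h : hstate) : R :=
  fst h (agent k) + rsum k (fun t => if rcv k t then snd h (agent k) t else 0).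

Definition split_step (k : nat) (h : hstate) : hstate :=
  let i := agent k in
  (fun a => if Nat.eqb a i then A i i * split_half k h else fst h a,
   fun a t => if Nat.eqb t k then (if E i a then A a i * split_half k h else 0)
              else if Nat.eqb a i && rcv k t then 0 else snd h a t).

(** The effect of one unit of fresh mass arriving at the active agent just before it splits;
    gradient increments enter in this way. *)
Definition split_inject (k : nat) : hstate :=
  let i := agent k in
  (fun a => if Nat.eqb a i then A i i else 0,
   fun a t => if Nat.eqb t k then (if E i a then A a i else 0) else 0).

(** Mass in transit is credited to its addressee. *)
Definition hold (k : nat) (h : hstate) (a : nat) : R := fst h a + rsum k (snd h a).
Definition mass (k : nat) (h : hstate) : R := rsum V (hold k h).
Definition habs (h : hstate) : hstate :=
  (fun a => Rabs (fst h a), fun a t => Rabs (snd h a t)).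
Definition hnonneg (k : nat) (h : hstate) : Prop :=
  (forall a, (a < V)%nat -> 0 <= fst h a) /\
  (forall a t, (a < V)%nat -> (t < k)%nat -> 0 <= snd h a t).
Definition hle (k : nat) (h h' : hstate) : Prop :=
  (forall a, (a < V)%nat -> fst h a <= fst h' a) /\
  (forall a t, (a < V)%nat -> (t < k)%nat -> snd h a t <= snd h' a t).
(** The l1 norm contracts only on the hyperplane of total mass zero, which is invariant; hence the
    two conditions travel together. *)
Definition balanced (k : nat) (h : hstate) (r : R) : Prop :=
  mass k h = 0 /\ mass k (habs h) <= r.

Lemma split_weight_nonneg i j : (i < V)%nat -> (j < V)%nat -> 0 <= A i j.
Proof.
  intros Hi Hj. destruct (Nat.eq_dec i j) as [->|Hne].
  - pose proof (HAd j Hj); lra.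
  - destruct (E j i) eqn:He.
    + pose proof (HAe i j Hi Hj He); lra.
    + rewrite HA0 by auto; lra.
Qed.

Lemma split_half_lin k a h b h' :
  split_half k (hlin a h b h') = a * split_half k h + b * split_half k h'.
Proof.
  unfold split_half; simpl.
  rewrite (rsum_ext k _ (fun t => a * (if rcv k t then snd h (agent k) t else 0)
                               + b * (if rcv k t then snd h' (agent k) t else 0))).
  - rewrite rsum_lin; ring.
  - intros t _. destruct (rcv k t); ring.
Qed.

Lemma split_step_lin k a h b h' :
  split_step k (hlin a h b h') = hlin a (split_step k h) b (split_step k h').
Proof.
  apply hstate_ext; unfold split_step; simpl; rewrite split_half_lin.
  - intros c. destruct (Nat.eqb c (agent k)); ring.
  - intros c t. destruct (Nat.eqb t k).
    + destruct (E (agent k) c); ring.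
    + destruct (Nat.eqb c (agent k) && rcv k t); ring.
Qed.

Lemma mass_lin k a h b h' : mass k (hlin a h b h') = a * mass k h + b * mass k h'.
Proof.
  unfold mass. rewrite <- rsum_lin. apply rsum_ext. intros i _.
  unfold hold; simpl. rewrite rsum_lin; ring.
Qed.

Lemma mass_le k h h' : hle k h h' -> mass k h <= mass k h'.
Proof.
  intros [Hz Hp]. apply rsum_le. intros a Ha. unfold hold.
  apply Rplus_le_compat; [auto|]. apply rsum_le; auto.
Qed.

(** The active agent gives up [split_half], and column [agent k] of [A] distributes it again.
    Summing over [a] then gives conservation of mass. *)
Lemma hold_step k h a : (a < V)%nat ->
  hold (S k) (split_step k h) a
  = hold k h a + A a (agent k) * split_half k h
    - (if Nat.eqb a (agent k) then split_half k h else 0).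
Proof.
  intros Ha. unfold hold, split_step; simpl. rewrite Nat.eqb_refl.
  rewrite (rsum_ext k _ (fun t => snd h a t
     - (if Nat.eqb a (agent k) then (if rcv k t then snd h (agent k) t else 0) else 0))).
  2:{ intros t Ht. destruct (Nat.eqb_spec t k); [lia|].
      destruct (Nat.eqb_spec a (agent k)) as [->|]; simpl; [destruct (rcv k t)|]; ring. }
  rewrite rsum_minus. destruct (Nat.eqb_spec a (agent k)) as [->|Hne].
  - rewrite HEloop. unfold split_half. ring.
  - rewrite (rsum_eq_0 k (fun _ => 0)) by auto.
    destruct (E (agent k) a) eqn:He; [ring|]. rewrite HA0 by auto. ring.
Qed.

Lemma mass_step k h : mass (S k) (split_step k h) = mass k h.
Proof.
  unfold mass. rewrite (rsum_ext V _ _ (hold_step k h)).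
  rewrite rsum_minus, rsum_plus, rsum_single by apply Hagent.
  rewrite (rsum_ext V (fun a => A a (agent k) * split_half k h)
             (fun a => split_half k h * A a (agent k))) by (intros; ring).
  rewrite rsum_scal, HAcol by apply Hagent.
  change (rsum V (fun a => hold k h a)) with (rsum V (hold k h)). ring.
Qed.

Lemma mass_iter k m h : mass (k + m) (evolve split_step k m h) = mass k h.
Proof.
  induction m as [|m IH]; simpl; [rewrite Nat.add_0_r; reflexivity|].
  rewrite Nat.add_succ_r, mass_step. exact IH.
Qed.

Lemma mass_inject k : mass (S k) (split_inject k) = 1.
Proof.
  rewrite <- (HAcol _ (Hagent k)). apply rsum_ext. intros a Ha.
  unfold hold, split_inject; simpl. rewrite Nat.eqb_refl, rsum_eq_0.
  - destruct (Nat.eqb_spec a (agent k)) as [->|Hne].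
    + rewrite HEloop; ring.
    + destruct (E (agent k) a) eqn:He; [ring|]. rewrite HA0 by auto. ring.
  - intros t Ht. destruct (Nat.eqb_spec t k); [lia|reflexivity].
Qed.

Lemma hnonneg_inject k : hnonneg (S k) (split_inject k).
Proof.
  split; unfold split_inject; simpl.
  - intros a Ha. destruct (Nat.eqb a (agent k)); [|lra].
    apply split_weight_nonneg; auto.
  - intros a t Ha Ht. destruct (Nat.eqb t k); [|lra].
    destruct (E (agent k) a); [|lra]. apply split_weight_nonneg; auto.
Qed.

Lemma habs_hnonneg k h : hnonneg k (habs h).
Proof. split; intros; apply Rabs_pos. Qed.

Lemma mass_habs_hnonneg k h : hnonneg k h -> mass k (habs h) = mass k h.
Proof.
  intros [Hz Hp]. apply rsum_ext. intros a Ha. unfold hold; simpl.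
  rewrite Rabs_pos_eq by auto. f_equal. apply rsum_ext. intros t Ht.
  apply Rabs_pos_eq; auto.
Qed.

Lemma mass_hnonneg k h : hnonneg k h -> 0 <= mass k h.
Proof.
  intros [Hz Hp]. apply rsum_nonneg. intros a Ha. unfold hold.
  pose proof (Hz a Ha). pose proof (rsum_nonneg k (snd h a) ltac:(auto)). lra.
Qed.

Lemma mass_habs_lin k a h b h' : mass k (habs (hlin a h b h'))
  <= Rabs a * mass k (habs h) + Rabs b * mass k (habs h').
Proof.
  rewrite <- mass_lin. apply mass_le. split; simpl; intros;
    (eapply Rle_trans; [apply Rabs_triang|]); rewrite !Rabs_mult; lra.
Qed.

Lemma fst_le_mass_habs k h a : (a < V)%nat -> Rabs (fst h a) <= mass k (habs h).
Proof.
  intros Ha.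
  assert (Hh : Rabs (fst h a) <= hold k (habs h) a).
  { unfold hold; simpl.
    pose proof (rsum_nonneg k (fun t => Rabs (snd h a t)) ltac:(intros; apply Rabs_pos)).
    lra. }
  eapply Rle_trans; [exact Hh|]. apply rsum_term_le; [|exact Ha].
  intros j _. unfold hold; simpl.
  pose proof (rsum_nonneg k (fun t => Rabs (snd h j t)) ltac:(intros; apply Rabs_pos)).
  pose proof (Rabs_pos (fst h j)). lra.
Qed.

Lemma split_half_abs k h : Rabs (split_half k h) <= split_half k (habs h).
Proof.
  unfold split_half; simpl. eapply Rle_trans; [apply Rabs_triang|].
  apply Rplus_le_compat_l. eapply Rle_trans; [apply rsum_abs|]. apply rsum_le.
  intros t _. destruct (rcv k t); [lra|]. rewrite Rabs_R0; lra.
Qed.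

(** The weights are nonnegative, so the absolute value of a step is dominated by the step of the
    absolute values, whose mass is conserved. *)
Lemma mass_habs_step k h : mass (S k) (habs (split_step k h)) <= mass k (habs h).
Proof.
  rewrite <- (mass_step k (habs h)). apply mass_le.
  pose proof (split_half_abs k h) as Hs.
  assert (Hw : forall a, (a < V)%nat ->
    Rabs (A a (agent k) * split_half k h) <= A a (agent k) * split_half k (habs h)).
  { intros a Ha. pose proof (split_weight_nonneg a (agent k) Ha (Hagent k)).
    rewrite Rabs_mult, (Rabs_pos_eq (A _ _)) by assumption.
    apply Rmult_le_compat_l; assumption. }
  split; unfold split_step; simpl.
  - intros a Ha. destruct (Nat.eqb a (agent k)); [apply Hw; auto | lra].
  - intros a t Ha Ht. destruct (Nat.eqb t k).
    + destruct (E (agent k) a); [auto|]. rewrite Rabs_R0; lra.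
    + destruct (Nat.eqb a (agent k) && rcv k t); [rewrite Rabs_R0|]; lra.
Qed.

Lemma split_half_ge k h : hnonneg k h -> fst h (agent k) <= split_half k h.
Proof.
  intros [Hz Hp]. unfold split_half.
  pose proof (rsum_nonneg k (fun t => if rcv k t then snd h (agent k) t else 0)) as Hn.
  enough (0 <= rsum k (fun t => if rcv k t then snd h (agent k) t else 0)) by lra.
  apply Hn. intros t Ht. destruct (rcv k t); [auto|lra].
Qed.

Lemma hnonneg_step k h : hnonneg k h -> hnonneg (S k) (split_step k h).
Proof.
  intros Hn. pose proof (split_half_ge k h Hn) as Hs. destruct Hn as [Hz Hp].
  pose proof (Hz _ (Hagent k)).
  assert (Hw : forall a, (a < V)%nat -> 0 <= A a (agent k) * split_half k h).
  { intros a Ha. apply Rmult_le_pos; [apply split_weight_nonneg; auto | lra]. }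
  split; unfold split_step; simpl.
  - intros a Ha. destruct (Nat.eqb a (agent k)); auto.
  - intros a t Ha Ht. destruct (Nat.eqb_spec t k).
    + destruct (E (agent k) a); [auto | lra].
    + destruct (Nat.eqb a (agent k) && rcv k t); [lra|]. apply Hp; auto; lia.
Qed.

Lemma hnonneg_iter k m h : hnonneg k h -> hnonneg (k + m) (evolve split_step k m h).
Proof.
  intros Hn. induction m as [|m IH]; simpl; [rewrite Nat.add_0_r; exact Hn|].
  rewrite Nat.add_succ_r. apply hnonneg_step, IH.
Qed.

(** The index of [hold] stays at [k] while the state evolves: only messages sent before [k] count.
    They can only move into the agent's own value, and each step retains at least the fraction
    [mbar]. *)
Lemma split_keep_old k s h a : hnonneg k h -> (a < V)%nat ->
  mbar ^ s * hold k h a <= hold k (evolve split_step k s h) a.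
Proof.
  intros Hn Ha. induction s as [|s IH]; [simpl; lra|].
  pose proof (hnonneg_iter k s h Hn) as [Hz Hp].
  set (h' := evolve split_step k s h) in *.
  assert (Hpk : forall t, (t < k)%nat -> 0 <= snd h' a t) by (intros; apply Hp; auto; lia).
  apply Rle_trans with (mbar * hold k h' a).
  { simpl. rewrite Rmult_assoc. apply Rmult_le_compat_l; lra. }
  assert (Hnew : hold k (split_step (k + s) h') a
    = (if Nat.eqb a (agent (k + s))
       then A (agent (k + s)) (agent (k + s)) * split_half (k + s) h' else fst h' a)
      + rsum k (fun t =>
          if Nat.eqb a (agent (k + s)) && rcv (k + s) t then 0 else snd h' a t)).
  { unfold hold, split_step; simpl. f_equal. apply rsum_ext.
    intros t Ht. destruct (Nat.eqb_spec t (k + s)); [lia|reflexivity]. }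
  simpl evolve; fold h'. rewrite Hnew. unfold hold.
  destruct (Nat.eqb_spec a (agent (k + s))) as [Hea|Hea]; simpl.
  (* Old messages are either received now, and then scaled by [A a a >= mbar] together with the
     value, or remain pending untouched. *)
  - assert (Hsplit : rsum k (snd h' a)
      = rsum k (fun t => if rcv (k + s) t then snd h' a t else 0)
        + rsum k (fun t => if rcv (k + s) t then 0 else snd h' a t)).
    { rewrite <- rsum_plus. apply rsum_ext. intros t _. destruct (rcv (k + s) t); ring. }
    assert (Hhalf : fst h' a + rsum k (fun t => if rcv (k + s) t then snd h' a t else 0)
                    <= split_half (k + s) h').
    { unfold split_half. rewrite <- Hea, rsum_split.
      pose proof (rsum_nonneg s (fun t => if rcv (k + s) (k + t) then snd h' a (k + t)%nat
                                          else 0)) as Hns.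
      enough (0 <= rsum s (fun t => if rcv (k + s) (k + t) then snd h' a (k + t)%nat
                                    else 0)) by lra.
      apply Hns. intros t Ht. destruct (rcv _ _); [|lra]. apply Hp; auto; lia. }
    assert (0 <= rsum k (fun t => if rcv (k + s) t then snd h' a t else 0)).
    { apply rsum_nonneg. intros t Ht. destruct (rcv _ _); [auto | lra]. }
    assert (0 <= rsum k (fun t => if rcv (k + s) t then 0 else snd h' a t)).
    { apply rsum_nonneg. intros t Ht. destruct (rcv _ _); [lra | auto]. }
    pose proof (Hz a Ha). rewrite <- Hea, Hsplit.
    pose proof (HAd a Ha). nra.
  - change (fun t => snd h' a t) with (snd h' a).
    pose proof (Hz a Ha). pose proof (rsum_nonneg k (snd h' a) Hpk). nra.
Qed.

Lemma split_decay k s h a : hnonneg k h -> (a < V)%nat ->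
  mbar ^ s * fst h a <= fst (evolve split_step k s h) a.
Proof.
  intros Hn Ha. induction s as [|s IH]; [simpl; lra|].
  pose proof (hnonneg_iter k s h Hn) as Hn'.
  apply Rle_trans with (mbar * fst (evolve split_step k s h) a).
  { simpl. rewrite Rmult_assoc. apply Rmult_le_compat_l; lra. }
  simpl. pose proof (split_half_ge _ _ Hn') as Hh. destruct Hn' as [Hz Hp].
  pose proof (Hz a Ha). pose proof (HAd a Ha).
  destruct (Nat.eqb_spec a (agent (k + s))) as [He|He]; [rewrite <- He in *|]; nra.
Qed.

(** An activation at least [D] steps after [k] receives everything sent before [k], and no later
    step writes to these old slots again except to clear them. *)
Lemma split_old_received k s1 s h a t : agent (k + s1) = a -> (D <= s1)%nat ->
  (s1 < s)%nat -> (t < k)%nat -> snd (evolve split_step k s h) a t = 0.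
Proof.
  intros Ha HD Hs Ht. induction s as [|s IH]; [lia|]. simpl.
  destruct (Nat.eqb_spec t (k + s)); [lia|].
  destruct (Nat.eq_dec s s1) as [->|Hne].
  - rewrite Ha, Nat.eqb_refl, Hrcv by lia. reflexivity.
  - rewrite IH by lia. destruct (_ && _); reflexivity.
Qed.

Lemma split_collect k h a : hnonneg k h -> (a < V)%nat ->
  mbar ^ (D + T) * hold k h a <= fst (evolve split_step k (D + T) h) a.
Proof.
  intros Hn Ha. eapply Rle_trans; [apply split_keep_old; eassumption|].
  unfold hold. destruct (HT (k + D) a Ha) as (t1 & Ht1 & Hat1).
  rewrite rsum_eq_0; [lra|]. intros t Ht.
  apply (split_old_received k (t1 - k)); try lia.
  rewrite <- Hat1. f_equal; lia.
Qed.

Definition split_reach (N j i : nat) : Prop := forall k h, hnonneg k h ->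
  mbar ^ N * fst h j <= fst (evolve split_step k N h) i.

(** Within [T] steps [j] sends the fraction [A i j >= mbar] of its mass to [i]; once sent it counts
    in the holding of [i], and [split_collect] turns it into value within [D + T] steps. *)
Lemma split_reach_edge j i : E j i = true -> split_reach (T + (D + T)) j i.
Proof.
  intros He k h Hn. destruct (HEV _ _ He) as [Hj Hi].
  destruct (HT k j Hj) as (t0 & Ht0 & Hat0).
  set (s0 := (t0 - k)%nat). assert (Ets : t0 = (k + s0)%nat) by (unfold s0; lia).
  rewrite Ets in Hat0.
  pose proof (hnonneg_iter k s0 h Hn) as Hn0.
  pose proof (hnonneg_iter k (S s0) h Hn) as Hn1.
  assert (Hsent : mbar ^ S s0 * fst h j <= hold (k + S s0) (evolve split_step k (S s0) h) i).
  { pose proof (split_decay k s0 h j Hn Hj) as Hd.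
    pose proof (split_half_ge _ _ Hn0) as Hh. rewrite Hat0 in Hh.
    destruct Hn1 as [Hz Hp].
    apply Rle_trans with (snd (evolve split_step k (S s0) h) i (k + s0)%nat).
    - simpl. rewrite Nat.eqb_refl, Hat0, He. rewrite Rmult_assoc.
      pose proof (HAe i j Hi Hj He).
      apply Rmult_le_compat; try lra.
      apply Rmult_le_pos; [apply pow_le; lra | apply Hn; exact Hj].
    - unfold hold. pose proof (Hz i Hi).
      pose proof (rsum_term_le (k + S s0)
        (snd (evolve split_step k (S s0) h) i) (k + s0)%nat
        ltac:(intros; apply Hp; auto) ltac:(lia)). lra. }
  replace (T + (D + T))%nat with (S s0 + ((D + T) + (T - S s0)))%nat by lia.
  rewrite evolve_add, evolve_add, (pow_add _ (S s0)), (pow_add _ (D + T)).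
  eapply Rle_trans;
    [|apply split_decay; [apply hnonneg_iter, hnonneg_iter; exact Hn | exact Hi]].
  replace (mbar ^ S s0 * (mbar ^ (D + T) * mbar ^ (T - S s0)) * fst h j) with
    (mbar ^ (T - S s0) * (mbar ^ (D + T) * (mbar ^ S s0 * fst h j))) by ring.
  apply Rmult_le_compat_l; [apply pow_le; lra|].
  eapply Rle_trans; [|apply split_collect; [apply hnonneg_iter; exact Hn | exact Hi]].
  apply Rmult_le_compat_l; [apply pow_le; lra | exact Hsent].
Qed.

Lemma split_positivity : exists N eta, (0 < N)%nat /\ 0 < eta < 1 /\
  forall k h i, (i < V)%nat -> hnonneg k h ->
    eta * mass k h <= fst (evolve split_step k N h) i.
Proof.
  destruct (uniform_reach V E split_reach (T + (D + T)) HEV HEconn) as [N HN].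
  - intros j Hj k h Hn. simpl. lra.
  - intros N j i Hj Hi HN k h Hn. specialize (HN k h Hn).
    rewrite <- (Nat.add_1_r N), evolve_add.
    eapply Rle_trans; [|apply split_decay; [apply hnonneg_iter; exact Hn | exact Hi]].
    rewrite pow_add, Rmult_assoc, (Rmult_comm (mbar ^ N)), Rmult_assoc.
    apply Rmult_le_compat_l; [apply pow_le; lra|]. lra.
  - intros N M j i l Hj Hi Hl' HN HM k h Hn.
    rewrite evolve_add. eapply Rle_trans; [|apply HM, hnonneg_iter; exact Hn].
    rewrite pow_add, (Rmult_comm (mbar ^ N)), Rmult_assoc.
    apply Rmult_le_compat_l; [apply pow_le; lra | apply HN; exact Hn].
  - intros j i He. apply split_reach_edge; exact He.
  - assert (HT0 : (0 < T)%nat) by (destruct (HT 0 0 HV) as (t & Ht & _); lia).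
    assert (HV1 : 1 <= INR V) by (change 1 with (INR 1); apply le_INR; lia).
    assert (Hp : 0 < mbar ^ (D + T + N)) by (apply pow_lt; lra).
    assert (Hp1 : mbar ^ (D + T + N) < 1).
    { apply Rle_lt_trans with (mbar ^ 1); [apply pow_unit_le; auto; lia | simpl; lra]. }
    (* Each holding separately gives a bound [mbar ^ (D + T + N) * hold k h a] on the value of [i];
       averaging these [V] bounds produces the division by [INR V]. *)
    exists (D + T + N)%nat, (mbar ^ (D + T + N) / INR V).
    split; [lia|]. split.
    + split; [apply Rdiv_lt_0_compat; lra|].
      apply Rmult_lt_reg_r with (INR V); [lra|].
      replace (mbar ^ (D + T + N) / INR V * INR V) with (mbar ^ (D + T + N))
        by (field; lra). lra.
    + intros k h i Hi Hn.
      apply Rmult_le_reg_l with (INR V); [lra|].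
      replace (INR V * (mbar ^ (D + T + N) / INR V * mass k h)) with
        (mbar ^ (D + T + N) * mass k h) by (field; lra).
      rewrite <- rsum_const. unfold mass. rewrite <- rsum_scal.
      apply rsum_le. intros a Ha. rewrite evolve_add.
      eapply Rle_trans; [|apply HN; [exact Ha | exact Hi | apply hnonneg_iter; exact Hn]].
      rewrite (pow_add _ (D + T)), (Rmult_comm (mbar ^ (D + T))), Rmult_assoc.
      apply Rmult_le_compat_l; [apply pow_le; lra | apply split_collect; assumption].
Qed.

(* The positive and negative parts of a balanced state have equal mass, and part of
   both ends up at agent 0, where it cancels. *)
Lemma split_contraction N eta : 0 < eta ->
  (forall k h i, (i < V)%nat -> hnonneg k h ->
    eta * mass k h <= fst (evolve split_step k N h) i) ->
  forall k h, mass k h = 0 ->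
    mass (k + N) (habs (evolve split_step k N h)) <= (1 - eta) * mass k (habs h).
Proof.
  intros Heta HN k h H0.
  (* Positive and negative parts of [h]. *)
  set (hp := hlin (1/2) (habs h) (1/2) h). set (hn := hlin (1/2) (habs h) (-(1/2)) h).
  assert (Hpos : hnonneg k hp /\ hnonneg k hn).
  { unfold hp, hn; repeat split; simpl; intros;
    [pose proof (Rle_abs (- fst h a)) as Hq | pose proof (Rle_abs (- snd h a t)) as Hq
    |pose proof (Rle_abs (fst h a)) | pose proof (Rle_abs (snd h a t))];
    try rewrite Rabs_Ropp in Hq; lra. }
  destruct Hpos as [Hhp Hhn].
  assert (Hmp : mass k hp = mass k (habs h) / 2)
    by (unfold hp; rewrite mass_lin, H0; field).
  assert (Hmn : mass k hn = mass k (habs h) / 2)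
    by (unfold hn; rewrite mass_lin, H0; field).
  replace h with (hlin 1 hp (-1) hn) at 1
    by (apply hstate_ext; intros; unfold hp, hn; simpl; field).
  rewrite evolve_hlin by exact split_step_lin.
  pose proof (HN k hp O HV Hhp) as Hp0. pose proof (HN k hn O HV Hhn) as Hn0.
  pose proof (hnonneg_iter k N hp Hhp) as [Hpz Hpp].
  pose proof (hnonneg_iter k N hn Hhn) as [Hnz Hnp].
  pose proof (mass_iter k N hp) as Mp. pose proof (mass_iter k N hn) as Mn.
  set (P := evolve split_step k N hp) in *. set (Q := evolve split_step k N hn) in *.
  rewrite Hmp in Hp0. rewrite Hmn in Hn0.
  (* At agent 0 both parts are at least [eta * mass k (habs h) / 2], and the absolute value of a
     difference of nonnegative numbers is their sum minus twice the smaller one. *)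
  apply Rle_trans with (rsum V (fun a => hold (k + N) P a + hold (k + N) Q a
                          - (if Nat.eqb a 0 then eta * mass k (habs h) else 0))).
  - apply rsum_le. intros a Ha. unfold hold; simpl.
    assert (Hs : rsum (k + N) (fun t => Rabs (1 * snd P a t + -1 * snd Q a t))
                 <= rsum (k + N) (snd P a) + rsum (k + N) (snd Q a)).
    { rewrite <- rsum_plus. apply rsum_le. intros t Ht.
      pose proof (Hpp a t Ha Ht). pose proof (Hnp a t Ha Ht). apply Rabs_le; lra. }
    enough (Rabs (1 * fst P a + -1 * fst Q a)
            <= fst P a + fst Q a - (if Nat.eqb a 0 then eta * mass k (habs h) else 0))
      by lra.
    pose proof (Hpz a Ha). pose proof (Hnz a Ha).
    destruct (Nat.eqb_spec a 0) as [->|Hne]; apply Rabs_le; lra.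
  - rewrite rsum_minus, rsum_plus, rsum_single by exact HV.
    unfold mass in Mp at 1; unfold mass in Mn at 1. lra.
Qed.

Lemma split_envelope : exists rho c, 0 < rho < 1 /\ 0 < c /\
  forall (h w : nat -> hstate) (r0 : R) (e r : nat -> R),
    0 <= r0 -> balanced 0 (h O) r0 ->
    (forall k, 0 <= e k) ->
    (forall k, h (S k) = hlin 1 (split_step k (h k)) 1 (w k)) ->
    (forall k, balanced (S k) (w k) (e k)) ->
    r O = c * r0 -> (forall k, r (S k) = rho * r k + c * e k) ->
    forall k, balanced k (h k) (r k).
Proof.
  destruct split_positivity as (N & eta & HN0 & Heta & HN).
  apply (envelope split_step balanced eta N); auto.
  - apply split_step_lin.
  - intros k h r r' Hr [H0 Hb]. split; [exact H0 | lra].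
  - intros k h h' r r' [H0 Hb] [H0' Hb']. split.
    + rewrite mass_lin, H0, H0'; ring.
    + eapply Rle_trans; [apply mass_habs_lin|]. rewrite Rabs_R1; lra.
  - intros k h r [H0 Hb]. split; [rewrite mass_step; exact H0|].
    eapply Rle_trans; [apply mass_habs_step | exact Hb].
  - intros k h r Hr [H0 Hb]. split; [rewrite mass_iter; exact H0|].
    eapply Rle_trans; [apply (split_contraction N eta); auto; lra|].
    apply Rmult_le_compat_l; lra.
Qed.

End MassSplitting.

(** * Euclidean norm and the descent inequality *)

Lemma Rabs_le_inv x y : Rabs x <= y -> - y <= x <= y.
Proof.
  intros Hx. pose proof (Rle_abs x). pose proof (Rle_abs (- x)) as Hn.
  rewrite Rabs_Ropp in Hn. lra.
Qed.

Lemma inner_lin_r n u a v b w :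
  inner n u (vadd (vscale a v) (vscale b w)) = a * inner n u v + b * inner n u w.
Proof.
  unfold inner. rewrite <- rsum_lin. apply rsum_ext. intros l _.
  unfold vadd, vscale; ring.
Qed.

Lemma inner_vsum_l n m F v : inner n (vsum m F) v = rsum m (fun j => inner n (F j) v).
Proof.
  unfold inner, vsum. rewrite rsum_exchange. apply rsum_ext. intros l _.
  rewrite Rmult_comm, <- rsum_scal. apply rsum_ext. intros; ring.
Qed.

Lemma sqnorm_nonneg n v : 0 <= sqnorm n v.
Proof. apply rsum_nonneg. intros l _. nra. Qed.

Lemma norm_nonneg n v : 0 <= norm n v.
Proof. apply sqrt_pos. Qed.

Lemma norm_sqr n v : norm n v * norm n v = sqnorm n v.
Proof. apply sqrt_sqrt, sqnorm_nonneg. Qed.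

Lemma norm_ext n u v : (forall l, (l < n)%nat -> u l = v l) -> norm n u = norm n v.
Proof.
  intros Huv. unfold norm, sqnorm, inner. f_equal. apply rsum_ext.
  intros l Hl. rewrite Huv by assumption. reflexivity.
Qed.

Lemma sqr_le_le x y : 0 <= y -> x * x <= y * y -> x <= y.
Proof. intros Hy Hxy. nra. Qed.

Lemma cauchy_schwarz_sqr n u v : inner n u v * inner n u v <= sqnorm n u * sqnorm n v.
Proof.
  unfold sqnorm, inner. induction n as [|n IH]; simpl; [lra|].
  set (S := rsum n (fun l => u l * v l)) in *.
  assert (HU : 0 <= rsum n (fun l => u l * u l)) by (apply rsum_nonneg; intros; nra).
  assert (HV : 0 <= rsum n (fun l => v l * v l)) by (apply rsum_nonneg; intros; nra).
  set (U := rsum n (fun l => u l * u l)) in *. set (V := rsum n (fun l => v l * v l)) in *.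
  set (a := u n). set (b := v n).
  (* After squaring, this is the arithmetic-geometric mean inequality combined with the induction
     hypothesis [S^2 <= U V]. *)
  enough (2 * (S * (a * b)) <= U * (b * b) + V * (a * a)) by nra.
  assert (HUb : 0 <= U * (b * b)) by (apply Rmult_le_pos; nra).
  assert (HVa : 0 <= V * (a * a)) by (apply Rmult_le_pos; nra).
  apply sqr_le_le; [lra|].
  assert (0 <= (U * V - S * S) * ((a * b) * (a * b))) by (apply Rmult_le_pos; nra).
  pose proof (Rle_0_sqr (U * (b * b) - V * (a * a))) as Hs. unfold Rsqr in Hs. nra.
Qed.

Lemma cauchy_schwarz n u v : Rabs (inner n u v) <= norm n u * norm n v.
Proof.
  apply sqr_le_le; [apply Rmult_le_pos; apply norm_nonneg|].
  rewrite <- Rabs_mult, Rabs_pos_eq by nra.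
  replace (norm n u * norm n v * (norm n u * norm n v)) with
    ((norm n u * norm n u) * (norm n v * norm n v)) by ring.
  rewrite !norm_sqr. apply cauchy_schwarz_sqr.
Qed.

Lemma inner_le n u v : inner n u v <= norm n u * norm n v.
Proof. eapply Rle_trans; [apply Rle_abs | apply cauchy_schwarz]. Qed.

Lemma norm_vadd n u v : norm n (vadd u v) <= norm n u + norm n v.
Proof.
  pose proof (norm_nonneg n u). pose proof (norm_nonneg n v).
  apply sqr_le_le; [lra|]. rewrite norm_sqr.
  replace (sqnorm n (vadd u v)) with (sqnorm n u + 2 * inner n u v + sqnorm n v).
  - rewrite <- (norm_sqr n u), <- (norm_sqr n v). pose proof (inner_le n u v). nra.
  - unfold sqnorm, inner. rewrite <- rsum_scal, <- !rsum_plus. apply rsum_ext.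
    intros l _. unfold vadd; ring.
Qed.

Lemma norm_vscale n a v : norm n (vscale a v) = Rabs a * norm n v.
Proof.
  unfold norm. replace (sqnorm n (vscale a v)) with (Rsqr a * sqnorm n v).
  - rewrite sqrt_mult; [|apply Rle_0_sqr|apply sqnorm_nonneg].
    rewrite sqrt_Rsqr_abs. reflexivity.
  - unfold sqnorm, inner. rewrite <- rsum_scal. apply rsum_ext.
    intros l _. unfold vscale, Rsqr; ring.
Qed.

Lemma norm_vsum n m F : norm n (vsum m F) <= rsum m (fun j => norm n (F j)).
Proof.
  induction m as [|m IH]; simpl.
  - unfold norm, sqnorm, inner. rewrite rsum_eq_0; [rewrite sqrt_0; lra|].
    intros; unfold vsum; simpl; ring.
  - change (vsum (S m) F) with (vadd (vsum m F) (F m)).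
    eapply Rle_trans; [apply norm_vadd | lra].
Qed.

Lemma coord_le_norm n v l : (l < n)%nat -> Rabs (v l) <= norm n v.
Proof.
  intros Hl. apply sqr_le_le; [apply norm_nonneg|].
  rewrite norm_sqr, <- Rabs_mult, Rabs_pos_eq by nra.
  apply (rsum_term_le n (fun l => v l * v l)); [intros; nra | exact Hl].
Qed.

Lemma sqnorm_le_coords n v r : (forall l, (l < n)%nat -> Rabs (v l) <= r) ->
  sqnorm n v <= INR n * (r * r).
Proof.
  intros Hv. rewrite <- rsum_const. apply rsum_le. intros l Hl.
  specialize (Hv l Hl). pose proof (Rabs_pos (v l)).
  replace (v l * v l) with (Rabs (v l) * Rabs (v l))
    by (rewrite <- Rabs_mult; apply Rabs_pos_eq; nra). nra.
Qed.

Lemma norm_le_coords n v r : 0 <= r -> (forall l, (l < n)%nat -> Rabs (v l) <= r) ->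
  norm n v <= sqrt (INR n) * r.
Proof.
  intros Hr Hv. apply sqr_le_le; [apply Rmult_le_pos; [apply sqrt_pos | exact Hr]|].
  rewrite norm_sqr.
  replace (sqrt (INR n) * r * (sqrt (INR n) * r)) with
    (sqrt (INR n) * sqrt (INR n) * (r * r)) by ring.
  rewrite sqrt_sqrt by apply pos_INR. apply sqnorm_le_coords; exact Hv.
Qed.

Lemma gradient_along_line n f g y h t : is_gradient n f g ->
  derivable_pt_lim (fun s => f (vadd y (vscale s h))) t
                   (inner n (g (vadd y (vscale t h))) h).
Proof.
  intros Hg eps Heps. pose proof (norm_nonneg n h) as Hh.
  set (x := vadd y (vscale t h)).
  (* The [+ 1] keeps the denominators positive when [h] has norm zero. *)
  destruct (Hg x (eps / (2 * (norm n h + 1)))) as (delta & Hdelta & Hx).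
  { apply Rdiv_lt_0_compat; lra. }
  assert (Hd' : 0 < delta / (norm n h + 1)) by (apply Rdiv_lt_0_compat; lra).
  exists (mkposreal _ Hd'). intros s Hs Hsd. simpl in Hsd.
  assert (Hsp : 0 < Rabs s) by (apply Rabs_pos_lt; exact Hs).
  assert (Hnorm : norm n (vscale s h) < delta).
  { rewrite norm_vscale.
    apply Rlt_le_trans with (delta / (norm n h + 1) * (norm n h + 1)); [|right; field; lra].
    apply Rle_lt_trans with (Rabs s * (norm n h + 1)); [nra|].
    apply Rmult_lt_compat_r; lra. }
  specialize (Hx _ Hnorm).
  replace (vadd x (vscale s h)) with (vadd y (vscale (t + s) h)) in Hx
    by (apply functional_extensionality; intros l; unfold x, vadd, vscale; ring).
  replace (inner n (g x) (vscale s h)) with (s * inner n (g x) h) in Hx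
    by (unfold inner, vscale; rewrite <- rsum_scal; apply rsum_ext; intros; ring).
  rewrite norm_vscale in Hx.
  replace ((f (vadd y (vscale (t + s) h)) - f x) / s - inner n (g x) h) with
    ((f (vadd y (vscale (t + s) h)) - f x - s * inner n (g x) h) / s) by (field; exact Hs).
  unfold Rdiv. rewrite Rabs_mult, Rabs_inv.
  apply Rmult_lt_reg_r with (Rabs s); [exact Hsp|].
  rewrite Rmult_assoc, Rinv_l, Rmult_1_r by lra.
  eapply Rle_lt_trans; [exact Hx|].
  replace (eps / (2 * (norm n h + 1)) * (Rabs s * norm n h)) with
    (eps * Rabs s * (norm n h / (2 * (norm n h + 1)))) by (field; lra).
  assert (Hq : norm n h / (2 * (norm n h + 1)) < 1).
  { apply Rmult_lt_reg_r with (2 * (norm n h + 1)); [lra|].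
    replace (norm n h / (2 * (norm n h + 1)) * (2 * (norm n h + 1))) with (norm n h)
      by (field; lra). lra. }
  assert (0 < eps * Rabs s) by (apply Rmult_lt_0_compat; lra). nra.
Qed.

(** The mean value theorem along the segment replaces the usual integral, at the price of the
    constant [L] instead of [L / 2]. The absolute value appears because no sign of [L] is
    assumed. *)
Lemma descent_inequality n f g L : is_gradient n f g ->
  (forall x y, norm n (vsub (g x) (g y)) <= L * norm n (vsub x y)) ->
  forall y h, f (vadd y h) <= f y + inner n (g y) h + Rabs L * sqnorm n h.
Proof.
  intros Hg HL y h.
  destruct (MVT_cor2 (fun s => f (vadd y (vscale s h)))
              (fun s => inner n (g (vadd y (vscale s h))) h) 0 1 Rlt_0_1) as (c & Hc & Hc01).
  { intros c _. apply gradient_along_line; exact Hg. }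
  replace (vadd y (vscale 1 h)) with (vadd y h) in Hc
    by (apply functional_extensionality; intros l; unfold vadd, vscale; ring).
  replace (vadd y (vscale 0 h)) with y in Hc
    by (apply functional_extensionality; intros l; unfold vadd, vscale; ring).
  set (x := vadd y (vscale c h)) in *.
  assert (Hsplit : inner n (g x) h = inner n (g y) h + inner n (vsub (g x) (g y)) h).
  { unfold inner. rewrite <- rsum_plus. apply rsum_ext. intros l _. unfold vsub; ring. }
  pose proof (inner_le n (vsub (g x) (g y)) h) as Hi.
  assert (Hn : norm n (vsub (g x) (g y)) <= Rabs L * norm n h).
  { eapply Rle_trans; [apply HL|].
    replace (vsub x y) with (vscale c h)
      by (apply functional_extensionality; intros l; unfold x, vsub, vadd, vscale; ring).
    rewrite norm_vscale, (Rabs_pos_eq c) by lra.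
    pose proof (norm_nonneg n h). pose proof (Rle_abs L). pose proof (Rabs_pos L).
    apply Rle_trans with (Rabs L * (c * norm n h)).
    - apply Rmult_le_compat_r; [|lra]. apply Rmult_le_pos; lra.
    - apply Rmult_le_compat_l; nra. }
  pose proof (norm_nonneg n h). pose proof (norm_sqr n h).
  assert (norm n (vsub (g x) (g y)) * norm n h <= Rabs L * norm n h * norm n h)
    by (apply Rmult_le_compat_r; assumption).
  nra.
Qed.

(** * Lyapunov decrease *)

(** Convexity of the square with weights [rho] and [1 - rho] at the points [r] and
    [c * e / (1 - rho)]. *)
Lemma sqr_convex rho c r e : 0 < rho < 1 ->
  (rho * r + c * e) * (rho * r + c * e) <= rho * (r * r) + c * c / (1 - rho) * (e * e).
Proof.
  intros Hrho. set (x := c * e / (1 - rho)).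
  replace (c * e) with ((1 - rho) * x) by (unfold x; field; lra).
  replace (c * c / (1 - rho) * (e * e)) with ((1 - rho) * (x * x)) by (unfold x; field; lra).
  clearbody x.
  assert (0 <= rho * (1 - rho) * ((r - x) * (r - x)))
    by (apply Rmult_le_pos; [apply Rmult_le_pos; lra | apply Rle_0_sqr]).
  nra.
Qed.

Lemma sqr_add_le x y : (x + y) * (x + y) <= 2 * (x * x) + 2 * (y * y).
Proof. pose proof (Rle_0_sqr (x - y)) as H. unfold Rsqr in H. nra. Qed.

Local Ltac nonneg := first [lra | apply Rle_0_sqr | apply Rmult_le_pos; nonneg].

(* [F] is the objective at the weighted average, [G] the norm of its gradient there,
   [r] and [q] bound the consensus and tracking errors, [Z] is the length of the search
   direction and [ip] its inner product with the gradient. *)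
Lemma lyapunov_decrease rho1 c1 rho2 c2 eta1 eta L C3 C4 C5 :
  0 < rho1 < 1 -> 0 < rho2 < 1 -> 0 < eta1 -> 0 < eta -> 0 <= L ->
  0 <= C3 -> 0 <= C4 -> 0 <= C5 ->
  exists a cc Gam, 0 <= a /\ 0 < cc /\ 0 < Gam <= 1 /\
  forall gam beta G Z r q eps ip F F',
    0 <= gam <= Gam -> eta1 <= beta <= 1 ->
    0 <= G -> 0 <= Z -> 0 <= r -> 0 <= q -> 0 <= eps ->
    Z <= G + (C3 * r + C4 * q) ->
    eps <= C5 * (r + gam * Z) ->
    eta * (G * G) - G * (C3 * r + C4 * q) <= ip ->
    F' <= F - gam * beta * ip + L * ((gam * Z) * (gam * Z)) ->
    F' + a * ((rho1 * r + c1 * (gam * Z)) * (rho1 * r + c1 * (gam * Z)))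
       + (rho2 * q + c2 * (2 * eps)) * (rho2 * q + c2 * (2 * eps))
    <= F + a * (r * r) + q * q - cc * (gam * (G * G) + r * r).
Proof.
  intros Hr1 Hr2 He1 He HL H3 H4 H5.
  set (D1 := c1 * c1 / (1 - rho1)).
  set (D2 := 8 * (C5 * C5) * (c2 * c2 / (1 - rho2))).
  assert (HD1 : 0 <= D1) by (apply Rmult_le_pos; [nonneg | apply Rlt_le, Rinv_0_lt_compat; lra]).
  assert (HD2 : 0 <= c2 * c2 / (1 - rho2))
    by (apply Rmult_le_pos; [nonneg | apply Rlt_le, Rinv_0_lt_compat; lra]).
  assert (HD2' : 0 <= D2) by (unfold D2; nonneg).
  (* The contraction gain [a * (1 - rho1) * r^2] has to cover [D2 * r^2] from the gradient
     increments, one [r^2] from the cross terms, and one [r^2] that remains as decrease. *)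
  set (a := (D2 + 2) / (1 - rho1)).
  assert (Ha : a * (1 - rho1) = D2 + 2) by (unfold a; field; lra).
  assert (Ha0 : 0 <= a) by (apply Rmult_le_pos; [lra | apply Rlt_le, Rinv_0_lt_compat; lra]).
  set (M0 := L + a * D1 + D2).
  assert (HM0 : 0 <= M0) by (unfold M0; assert (0 <= a * D1) by (apply Rmult_le_pos; lra); lra).
  set (kap := eta1 * eta / 2).
  assert (Hkap : 0 < kap)
    by (unfold kap; pose proof (Rmult_lt_0_compat _ _ He1 He); lra).
  set (Pc := 2 * (C3 * C3) + 2 * (C4 * C4)).
  assert (HPc : 0 <= Pc)
    by (unfold Pc; apply Rplus_le_le_0_compat; nonneg).
  assert (Hie : 0 < / (2 * eta)) by (apply Rinv_0_lt_compat; lra).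
  set (M1 := / (2 * eta) + 2 * M0). assert (HM1 : 0 < M1) by (unfold M1; lra).
  assert (HM1P : 0 <= M1 * Pc) by (apply Rmult_le_pos; lra).
  (* Below [G1] the gradient part of the second-order terms [M0 * e^2] uses up at most half of the
     descent; below [G2] all terms in [s^2] are covered by the contraction of [r] and [q]. *)
  set (G1 := kap / (4 * M0 + 1)). set (G2 := (1 - rho2) / (M1 * Pc + 1)).
  assert (HG1 : 0 < G1) by (apply Rdiv_lt_0_compat; lra).
  assert (HG2 : 0 < G2) by (apply Rdiv_lt_0_compat; lra).
  assert (HG1e : G1 * (4 * M0 + 1) = kap) by (unfold G1; field; lra).
  assert (HG2e : G2 * (M1 * Pc + 1) = 1 - rho2) by (unfold G2; field; lra).
  exists a, (Rmin (kap / 2) 1), (Rmin 1 (Rmin G1 G2)).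
  split; [exact Ha0|]. split; [apply Rmin_pos; lra|].
  split; [split; [repeat apply Rmin_pos; lra | apply Rmin_l]|].
  intros gam beta G Z r q eps ip F F' [Hg0 Hg] Hbeta HG HZ Hr Hq Heps HZs Heps' Hip HF.
  assert (Hg1 : gam <= 1) by (eapply Rle_trans; [exact Hg | apply Rmin_l]).
  assert (HgG1 : gam <= G1)
    by (eapply Rle_trans; [exact Hg|]; eapply Rle_trans; [apply Rmin_r | apply Rmin_l]).
  assert (HgG2 : gam <= G2)
    by (eapply Rle_trans; [exact Hg|]; eapply Rle_trans; [apply Rmin_r | apply Rmin_r]).
  clear Hg. set (s := C3 * r + C4 * q) in *.
  assert (Hs : 0 <= s) by (unfold s; apply Rplus_le_le_0_compat; nonneg).
  assert (Hss : s * s <= Pc * (r * r + q * q)).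
  { unfold s. eapply Rle_trans; [apply sqr_add_le|]. unfold Pc.
    assert (0 <= C3 * C3 * (q * q)) by nonneg.
    assert (0 <= C4 * C4 * (r * r)) by nonneg. lra. }
  set (e := gam * Z) in *.
  assert (He0 : 0 <= e) by (apply Rmult_le_pos; assumption).
  assert (Hee : e * e <= 2 * (gam * gam) * (G * G + s * s)).
  { assert (e <= gam * (G + s)) by (apply Rmult_le_compat_l; assumption).
    assert (e * e <= gam * (G + s) * (gam * (G + s))) by (apply Rmult_le_compat; assumption).
    pose proof (sqr_add_le G s) as Hsq.
    assert (gam * gam * ((G + s) * (G + s)) <= gam * gam * (2 * (G * G) + 2 * (s * s)))
      by (apply Rmult_le_compat_l; [nonneg | lra]). lra. }
  (* Young: [G s <= eta G^2 / 2 + s^2 / (2 eta)] *)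
  assert (Hyoung : eta / 2 * (G * G) - / (2 * eta) * (s * s) <= ip).
  { eapply Rle_trans; [|exact Hip].
    assert (Hsq : 0 <= / (2 * eta) * ((eta * G - s) * (eta * G - s)))
      by nonneg.
    replace (/ (2 * eta) * ((eta * G - s) * (eta * G - s))) with
      (eta / 2 * (G * G) - G * s + / (2 * eta) * (s * s)) in Hsq by (field; lra). lra. }
  assert (Hgb : 0 <= gam * beta) by (apply Rmult_le_pos; lra).
  assert (Hdesc : kap * (gam * (G * G)) - / (2 * eta) * (gam * (s * s))
                  <= gam * beta * ip).
  { apply Rle_trans with (gam * beta * (eta / 2 * (G * G) - / (2 * eta) * (s * s)));
      [|apply Rmult_le_compat_l; assumption].
    assert (0 <= gam * (G * G) * (eta / 2) * (beta - eta1))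
      by nonneg.
    assert (0 <= gam * (s * s) * (/ (2 * eta)) * (1 - beta))
      by nonneg.
    unfold kap. lra. }
  pose proof (sqr_convex rho1 c1 r e Hr1) as Hr'. fold D1 in Hr'.
  pose proof (sqr_convex rho2 c2 q (2 * eps) Hr2) as Hq'.
  assert (Hepsq : c2 * c2 / (1 - rho2) * (2 * eps * (2 * eps)) <= D2 * (r * r + e * e)).
  { assert (eps * eps <= C5 * (r + e) * (C5 * (r + e))) by (apply Rmult_le_compat; assumption).
    pose proof (sqr_add_le r e) as Hsq.
    assert (C5 * C5 * ((r + e) * (r + e)) <= C5 * C5 * (2 * (r * r) + 2 * (e * e)))
      by (apply Rmult_le_compat_l; [nonneg | lra]).
    assert (4 * (eps * eps) <= 8 * (C5 * C5) * (r * r + e * e)) by lra.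
    assert (c2 * c2 / (1 - rho2) * (4 * (eps * eps))
            <= c2 * c2 / (1 - rho2) * (8 * (C5 * C5) * (r * r + e * e)))
      by (apply Rmult_le_compat_l; assumption).
    unfold D2. lra. }
  assert (Har : a * ((rho1 * r + c1 * e) * (rho1 * r + c1 * e))
                <= a * (r * r) - (D2 + 2) * (r * r) + a * D1 * (e * e)).
  { rewrite <- Ha.
    apply Rle_trans with (a * (rho1 * (r * r) + D1 * (e * e)));
      [apply Rmult_le_compat_l; assumption | right; ring]. }
  assert (HM0e : M0 * (e * e) <= kap / 2 * (gam * (G * G)) + 2 * M0 * (gam * (s * s))).
  { assert (M0 * (e * e) <= M0 * (2 * (gam * gam) * (G * G + s * s)))
      by (apply Rmult_le_compat_l; assumption).
    assert (Hk : 2 * M0 * gam <= kap / 2)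
      by (assert (0 <= (G1 - gam) * (4 * M0 + 1)) by nonneg; lra).
    assert (0 <= (kap / 2 - 2 * M0 * gam) * (gam * (G * G)))
      by nonneg.
    assert (0 <= M0 * gam * (1 - gam) * (s * s))
      by nonneg.
    lra. }
  assert (HM1s : M1 * (gam * (s * s)) <= (1 - rho2) * (r * r + q * q)).
  { apply Rle_trans with (M1 * (gam * (Pc * (r * r + q * q)))).
    - apply Rmult_le_compat_l; [lra|]. apply Rmult_le_compat_l; lra.
    - replace (M1 * (gam * (Pc * (r * r + q * q)))) with
        (gam * (M1 * Pc) * (r * r + q * q)) by ring.
      apply Rmult_le_compat_r;
        [assert (0 <= r * r) by nonneg; assert (0 <= q * q) by nonneg; lra|].
      assert (0 <= (G2 - gam) * (M1 * Pc + 1)) by nonneg. lra. }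
  assert (Hcc : Rmin (kap / 2) 1 * (gam * (G * G) + r * r)
                <= kap / 2 * (gam * (G * G)) + r * r).
  { pose proof (Rmin_l (kap / 2) 1). pose proof (Rmin_r (kap / 2) 1).
    assert (0 <= gam * (G * G)) by nonneg.
    assert (0 <= (kap / 2 - Rmin (kap / 2) 1) * (gam * (G * G))) by nonneg.
    assert (0 <= (1 - Rmin (kap / 2) 1) * (r * r)) by nonneg. lra. }
  unfold M0 in HM0e. unfold M1, M0 in HM1s.
  assert (0 <= rho2 * (r * r)) by nonneg.
  lra.
Qed.

(** * ASY-SONATA as two perturbed linear systems *)

(** This form turns the difference of two running totals into a selection among all times before
    [k], so that sums over senders and over times can be exchanged. *)
Lemma rsum_between k a b f : (a <= b)%nat -> (b <= k)%nat ->
  rsum b f - rsum a f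
  = rsum k (fun t => if Nat.leb a t && Nat.ltb t b then f t else 0).
Proof.
  intros Hab Hbk.
  assert (Hb : rsum b f = rsum a f + rsum (b - a) (fun i => f (a + i)%nat))
    by (rewrite <- rsum_split; f_equal; lia).
  transitivity (rsum (b - a) (fun i => f (a + i)%nat)); [lra|].
  replace k with (a + ((b - a) + (k - b)))%nat by lia.
  rewrite !rsum_split, (rsum_eq_0 a), (rsum_eq_0 (k - b)), Rplus_0_l, Rplus_0_r.
  - apply rsum_ext. intros i Hi. destruct (Nat.leb_spec a (a + i)); [|lia].
    destruct (Nat.ltb_spec (a + i) b); [reflexivity|lia].
  - intros i Hi. destruct (Nat.ltb_spec (a + (b - a + i)) b); [lia|].
    rewrite andb_false_r; reflexivity.
  - intros i Hi. destruct (Nat.leb_spec a i); [lia|reflexivity].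
Qed.

Section Algorithm.

Variables (n V T D : nat) (E : nat -> nat -> bool) (W A : nat -> nat -> R).
Variables (f : nat -> vec -> R) (g : nat -> vec -> vec) (L : nat -> R).
Variables (agent : nat -> nat) (d : nat -> nat -> nat).
Variables (gamma : nat -> R) (x0 : nat -> vec) (mbar : R).
Hypothesis HV : (0 < V)%nat.
Hypothesis Hgrad : forall i, (i < V)%nat -> is_gradient n (f i) (g i).
Hypothesis HLip : forall i, (i < V)%nat -> forall x y,
  norm n (vsub (g i x) (g i y)) <= L i * norm n (vsub x y).
Hypothesis Hbnd : exists lb, forall x, lb <= rsum V (fun i => f i x).
Hypothesis HEV : forall i j, E i j = true -> (i < V)%nat /\ (j < V)%nat.
Hypothesis HEloop : forall i, E i i = false.
Hypothesis HEconn : forall i j, (i < V)%nat -> (j < V)%nat ->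
  clos_refl_trans nat (fun a b => E a b = true) i j.
Hypothesis Hm : 0 < mbar < 1.
Hypothesis HWd : forall i, (i < V)%nat -> mbar <= W i i.
Hypothesis HWe : forall i j, (i < V)%nat -> (j < V)%nat -> E j i = true -> mbar <= W i j.
Hypothesis HW0 : forall i j,
  (i < V)%nat -> (j < V)%nat -> i <> j -> E j i = false -> W i j = 0.
Hypothesis HWrow : forall i, (i < V)%nat -> rsum V (fun j => W i j) = 1.
Hypothesis HAd : forall i, (i < V)%nat -> mbar <= A i i.
Hypothesis HAe : forall i j, (i < V)%nat -> (j < V)%nat -> E j i = true -> mbar <= A i j.
Hypothesis HA0 : forall i j,
  (i < V)%nat -> (j < V)%nat -> i <> j -> E j i = false -> A i j = 0.
Hypothesis HAcol : forall j, (j < V)%nat -> rsum V (fun i => A i j) = 1.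
Hypothesis Hagent : forall k, (agent k < V)%nat.
Hypothesis HT : forall k i, (i < V)%nat -> exists t, (k <= t < k + T)%nat /\ agent t = i.
Hypothesis Hd : forall k j, E j (agent k) = true -> (d k j <= D)%nat.
Hypothesis Hgamma : forall k, 0 <= gamma k.
Hypothesis Hgamma_small :
  forall eps, 0 < eps -> exists k0, forall k, (k0 <= k)%nat -> gamma k <= eps.

Definition run (k : nat) : state := asy_run V E W A g agent d gamma D x0 k.

Definition xnew (k : nat) : vec := sx (run (S k)) (agent k).

Definition grad_change (k : nat) : vec :=
  vsub (g (agent k) (xnew k)) (g (agent k) (sx (run k) (agent k))).

Definition zhalf (k : nat) : vec :=
  let i := agent k in
  vadd (vadd (sz (run k) i)
             (vsum V (fun j => if E j i
                then vsub (srho (run k) (stau (run (S k)) i j) i j) (srt (run k) i j)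
                else vzero)))
       (grad_change k).

(** Truncating negative times to 0 is harmless, since [v] vanishes at all times up to 0. *)
Definition src (k j : nat) : nat := Z.to_nat (stau (run (S k)) (agent k) j).

(** A share sent in iteration [t] first appears in the counter of time [t + 1], hence the strict
    comparison. Times at which a non-neighbour was active count as received, as nothing is pending
    from them. *)
Definition rcv (k t : nat) : bool :=
  negb (E (agent t) (agent k))
  || Z.ltb (Z.of_nat t) (stau (run (S k)) (agent k) (agent t)).

Lemma xnew_eq k : xnew k =
  vadd (vscale (W (agent k) (agent k))
               (vsub (sx (run k) (agent k)) (vscale (gamma k) (sz (run k) (agent k)))))
       (vsum V (fun j => if E j (agent k)
          then vscale (W (agent k) j) (sv (run k) (stau (run (S k)) (agent k) j) j)
          else vzero)).
Proof. unfold xnew, run; simpl. rewrite Nat.eqb_refl. reflexivity. Qed.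

Lemma sx_S k a : sx (run (S k)) a = if Nat.eqb a (agent k) then xnew k else sx (run k) a.
Proof. rewrite xnew_eq. reflexivity. Qed.

Lemma sz_S k a : sz (run (S k)) a =
  if Nat.eqb a (agent k) then vscale (A (agent k) (agent k)) (zhalf k) else sz (run k) a.
Proof. unfold zhalf, grad_change. rewrite xnew_eq. reflexivity. Qed.

Lemma stau_S k a j : stau (run (S k)) a j =
  if Nat.eqb a (agent k) && E j (agent k)
  then Z.max (stau (run k) a j) (Z.of_nat k - Z.of_nat (d k j))%Z
  else stau (run k) a j.
Proof. reflexivity. Qed.

Lemma srt_S k a j : srt (run (S k)) a j =
  if Nat.eqb a (agent k) && E j (agent k)
  then srho (run k) (stau (run (S k)) (agent k) j) (agent k) j else srt (run k) a j.
Proof. reflexivity. Qed.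

Lemma sv_S k t a : sv (run (S k)) t a =
  if Z.eqb t (Z.of_nat k + 1)
  then (if Nat.eqb a (agent k)
        then vsub (sx (run k) (agent k)) (vscale (gamma k) (sz (run k) (agent k)))
        else sv (run k) (Z.of_nat k) a)
  else sv (run k) t a.
Proof. reflexivity. Qed.

Lemma srho_S k t a b : srho (run (S k)) t a b =
  if Z.eqb t (Z.of_nat k + 1)
  then (if Nat.eqb b (agent k) && E (agent k) a
        then vadd (srho (run k) (Z.of_nat k) a (agent k)) (vscale (A a (agent k)) (zhalf k))
        else srho (run k) (Z.of_nat k) a b)
  else srho (run k) t a b.
Proof. unfold zhalf, grad_change. rewrite xnew_eq. reflexivity. Qed.

Lemma run_0 : run 0 = asy_init D g x0.
Proof. reflexivity. Qed.

Local Opaque run.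

Lemma sv_nonpos k t a : (t <= 0)%Z -> sv (run k) t a = vzero.
Proof.
  intros Ht. induction k as [|k IH]; [rewrite run_0; reflexivity|].
  rewrite sv_S. destruct (Z.eqb_spec t (Z.of_nat k + 1)); [lia|exact IH].
Qed.

Lemma srho_nonpos k t a b : (t <= 0)%Z -> srho (run k) t a b = vzero.
Proof.
  intros Ht. induction k as [|k IH]; [rewrite run_0; reflexivity|].
  rewrite srho_S. destruct (Z.eqb_spec t (Z.of_nat k + 1)); [lia|exact IH].
Qed.

Lemma stau_le k a j : (stau (run k) a j <= Z.of_nat k)%Z.
Proof.
  induction k as [|k IH]; [rewrite run_0; simpl; lia|].
  rewrite stau_S. destruct (_ && _); lia.
Qed.

Lemma stau_S_le k a j : (stau (run (S k)) a j <= Z.of_nat k)%Z.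
Proof. rewrite stau_S. pose proof (stau_le k a j). destruct (_ && _); lia. Qed.

Lemma stau_mono k a j : (stau (run k) a j <= stau (run (S k)) a j)%Z.
Proof. rewrite stau_S. destruct (_ && _); lia. Qed.

Lemma stau_fresh k j : E j (agent k) = true ->
  (Z.of_nat k - Z.of_nat D <= stau (run (S k)) (agent k) j)%Z.
Proof.
  intros He. rewrite stau_S, Nat.eqb_refl, He. pose proof (Hd k j He). simpl; lia.
Qed.

Lemma src_window k j : E j (agent k) = true -> (k - D <= src k j <= k)%nat.
Proof.
  intros He. unfold src.
  pose proof (stau_fresh k j He). pose proof (stau_S_le k (agent k) j). lia.
Qed.

Lemma rcv_old k t : (t + D < k)%nat -> rcv k t = true.
Proof.
  intros Ht. unfold rcv. destruct (E (agent t) (agent k)) eqn:He; [|reflexivity].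
  simpl. apply Z.ltb_lt. pose proof (stau_fresh k _ He). lia.
Qed.

(** * Message counters as running totals *)

Definition sent (a j l t : nat) : R := if Nat.eqb (agent t) j then A a j * zhalf t l else 0.

Lemma srho_sum k s a j l : E j a = true -> (s <= k)%nat ->
  srho (run k) (Z.of_nat s) a j l = rsum s (sent a j l).
Proof.
  intros He. revert s. induction k as [|k IH]; intros s Hs.
  - assert (s = O) as -> by lia. rewrite run_0; reflexivity.
  - rewrite srho_S. destruct (Z.eqb_spec (Z.of_nat s) (Z.of_nat k + 1)) as [Hsk|Hsk].
    + assert (s = S k) as -> by lia. simpl rsum. rewrite <- IH by lia. unfold sent.
      rewrite (Nat.eqb_sym (agent k) j).
      destruct (Nat.eqb_spec j (agent k)) as [->|Hne].
      * rewrite He. unfold vadd, vscale; simpl. ring.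
      * simpl. ring.
    + apply IH. lia.
Qed.

Lemma srho_sum_Z k t a j l : E j a = true -> (t <= Z.of_nat k)%Z ->
  srho (run k) t a j l = rsum (Z.to_nat t) (sent a j l).
Proof.
  intros He Ht. destruct (Z_le_gt_dec t 0).
  - rewrite srho_nonpos by assumption. replace (Z.to_nat t) with O by lia. reflexivity.
  - rewrite <- (srho_sum k) by (auto; lia). rewrite Z2Nat.id by lia. reflexivity.
Qed.

(** The buffer always equals the counter at the last time read, so the difference formed by the
    algorithm consists exactly of the shares sent between two successive read times. *)
Lemma srt_sum k a j l : E j a = true ->
  srt (run k) a j l = rsum (Z.to_nat (stau (run k) a j)) (sent a j l).
Proof.
  intros He. induction k as [|k IH].
  - rewrite run_0; simpl. replace (Z.to_nat (- Z.of_nat D)) with O by lia. reflexivity.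
  - rewrite srt_S. destruct (Nat.eqb_spec a (agent k)) as [->|Hne].
    + rewrite He. simpl. rewrite (srho_sum_Z k); auto. apply stau_S_le.
    + simpl. rewrite IH, stau_S. destruct (Nat.eqb_spec a (agent k)); [lia|]. reflexivity.
Qed.

Definition x_state (k l : nat) : hstate :=
  (fun a => sx (run k) a l, fun t a => sv (run k) (Z.of_nat t) a l).

(** The direct effect of a unit move of the active agent: it enters the published [v] in full, but
    the new iterate only through the self weight. *)
Definition x_inject (k : nat) : hstate :=
  (fun a => if Nat.eqb a (agent k) then W (agent k) (agent k) else 0,
   fun t a => if Nat.eqb t (S k) && Nat.eqb a (agent k) then 1 else 0).

Definition pending (k l a t : nat) : R :=
  if Nat.ltb t k && E (agent t) a && Z.leb (stau (run k) a (agent t)) (Z.of_nat t)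
  then A a (agent t) * zhalf t l else 0.

Definition z_state (k l : nat) : hstate := (fun a => sz (run k) a l, pending k l).

Notation xstep := (avg_step V E W agent src).
Notation zstep := (split_step E A agent rcv).
Notation direction k := (sz (run k) (agent k)).

Lemma x_state_S k l : x_state (S k) l =
  hlin 1 (xstep k (x_state k l)) (- (gamma k * sz (run k) (agent k) l)) (x_inject k).
Proof.
  apply hstate_ext; unfold x_state, x_inject, avg_step; cbn [fst snd hlin].
  - intros a. rewrite sx_S. destruct (Nat.eqb_spec a (agent k)) as [->|Hne]; [|ring].
    rewrite xnew_eq. unfold vadd, vscale, vsub, vsum.
    rewrite (rsum_ext V _ (fun j => if E j (agent k)
       then W (agent k) j * sv (run k) (Z.of_nat (src k j)) j l else 0)); [ring|].
    intros j _. destruct (E j (agent k)) eqn:He; [|reflexivity]. f_equal.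
    unfold src. destruct (Z_le_gt_dec (stau (run (S k)) (agent k) j) 0).
    + rewrite !sv_nonpos by lia. reflexivity.
    + rewrite Z2Nat.id by lia. reflexivity.
  - intros t a. rewrite sv_S.
    destruct (Nat.eqb_spec t (S k)) as [->|Hne].
    + destruct (Z.eqb_spec (Z.of_nat (S k)) (Z.of_nat k + 1)); [|lia].
      destruct (Nat.eqb a (agent k)); unfold vsub, vscale; simpl; ring.
    + destruct (Z.eqb_spec (Z.of_nat t) (Z.of_nat k + 1)); [lia|].
      destruct (Nat.eqb a (agent k)); simpl; ring.
Qed.

Lemma received_mass k l :
  vsum V (fun j => if E j (agent k)
    then vsub (srho (run k) (stau (run (S k)) (agent k) j) (agent k) j)
              (srt (run k) (agent k) j)
    else vzero) l
  = rsum k (fun t => if rcv k t then pending k l (agent k) t else 0).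
Proof.
  unfold vsum. set (i := agent k).
  rewrite (rsum_ext V _ (fun j => rsum k (fun t =>
    if E j i && (Z.leb (stau (run k) i j) (Z.of_nat t)
                 && Z.ltb (Z.of_nat t) (stau (run (S k)) i j))
    then sent i j l t else 0))).
  (* Each time has a single sender, so for fixed [t] the sum over [j] reduces to [j = agent t]. *)
  - rewrite rsum_exchange. apply rsum_ext. intros t Ht.
    rewrite (rsum_ext V _ (fun j => if Nat.eqb j (agent t)
        then (if rcv k t then pending k l i t else 0) else 0)).
    + apply rsum_single, Hagent.
    + intros j _. unfold sent. rewrite (Nat.eqb_sym (agent t) j).
      destruct (Nat.eqb_spec j (agent t)) as [->|Hne].
      * unfold rcv, pending. fold i. destruct (Nat.ltb_spec t k); [|lia].
        destruct (E (agent t) i); simpl; [|reflexivity].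
        destruct (Z.leb _ _), (Z.ltb _ _); reflexivity.
      * destruct (_ && _); reflexivity.
  - intros j _. destruct (E j i) eqn:He.
    + unfold vsub. rewrite (srho_sum_Z k), srt_sum by (auto; apply stau_S_le).
      pose proof (stau_mono k i j). pose proof (stau_S_le k i j).
      rewrite (rsum_between k) by lia. apply rsum_ext. intros t Ht. simpl.
      replace (Nat.leb (Z.to_nat (stau (run k) i j)) t)
        with (Z.leb (stau (run k) i j) (Z.of_nat t)).
      * replace (Nat.ltb t (Z.to_nat (stau (run (S k)) i j)))
          with (Z.ltb (Z.of_nat t) (stau (run (S k)) i j)); [reflexivity|].
        destruct (Z.ltb_spec (Z.of_nat t) (stau (run (S k)) i j)),
                 (Nat.ltb_spec t (Z.to_nat (stau (run (S k)) i j))); lia.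
      * destruct (Z.leb_spec (stau (run k) i j) (Z.of_nat t)),
                 (Nat.leb_spec (Z.to_nat (stau (run k) i j)) t); lia.
    + simpl. rewrite rsum_eq_0; auto.
Qed.

Lemma zhalf_split k l :
  zhalf k l = split_half agent rcv k (z_state k l) + grad_change k l.
Proof.
  unfold zhalf, split_half, vadd; cbn [fst snd z_state]. rewrite received_mass. ring.
Qed.

Lemma z_state_S k l : z_state (S k) l =
  hlin 1 (zstep k (z_state k l)) (grad_change k l) (split_inject E A agent k).
Proof.
  apply hstate_ext; unfold split_step, split_inject; cbn [fst snd hlin].
  - intros a. unfold z_state at 1; cbn [fst]. rewrite sz_S.
    destruct (Nat.eqb a (agent k)).
    + unfold vscale. rewrite zhalf_split. ring.
    + unfold z_state; simpl. ring.
  - intros a t. unfold z_state at 1; cbn [snd]. unfold pending.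
    destruct (Nat.eqb_spec t k) as [->|Hne].
    + destruct (Nat.ltb_spec k (S k)); [|lia].
      destruct (E (agent k) a); simpl andb; cbv iota; [|ring].
      (* Read times do not exceed [k], so what is sent in iteration [k] is still pending after
         it. *)
      pose proof (stau_S_le k a (agent k)).
      destruct (Z.leb_spec (stau (run (S k)) a (agent k)) (Z.of_nat k)); [|lia].
      rewrite zhalf_split. ring.
    + rewrite Rmult_0_r, Rplus_0_r, Rmult_1_l.
      unfold z_state; cbn [snd]. unfold pending.
      destruct (Nat.ltb_spec t (S k)), (Nat.ltb_spec t k); try lia; simpl andb; cbv iota;
        [|destruct (_ && _); reflexivity].
      pose proof (stau_mono k a (agent t)).
      destruct (Nat.eqb_spec a (agent k)) as [->|Hne'].
      * unfold rcv. destruct (E (agent t) (agent k)); simpl; [|reflexivity].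
        destruct (Z.ltb_spec (Z.of_nat t) (stau (run (S k)) (agent k) (agent t)));
        destruct (Z.leb_spec (stau (run (S k)) (agent k) (agent t)) (Z.of_nat t));
        destruct (Z.leb_spec (stau (run k) (agent k) (agent t)) (Z.of_nat t));
          try reflexivity; lia.
      * simpl andb; cbv iota. rewrite stau_S.
        destruct (Nat.eqb_spec a (agent k)); [lia|]. reflexivity.
Qed.

Definition grad_sum (k l : nat) : R := rsum V (fun a => g a (sx (run k) a) l).

Lemma grad_sum_S k l : grad_sum (S k) l = grad_sum k l + grad_change k l.
Proof.
  unfold grad_sum. rewrite <- (rsum_single V (agent k) (grad_change k l)) by apply Hagent.
  rewrite <- rsum_plus. apply rsum_ext. intros a _. rewrite sx_S.
  destruct (Nat.eqb_spec a (agent k)) as [->|]; unfold grad_change, vsub; ring.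
Qed.

(** The gradient tracking invariant: the initial mass is the sum of the initial gradients, and each
    iteration injects exactly the change of that sum. *)
Lemma mass_z_state k l : mass V k (z_state k l) = grad_sum k l.
Proof.
  induction k as [|k IH].
  - unfold mass, grad_sum. apply rsum_ext. intros a _.
    unfold hold; simpl. rewrite run_0; simpl. ring.
  - rewrite z_state_S, mass_lin.
    rewrite (mass_step V E A agent rcv), (mass_inject V E A agent) by assumption.
    rewrite IH, grad_sum_S. ring.
Qed.

Definition share (k : nat) : hstate :=
  evolve zstep 0 k (fun _ => / INR V, fun _ _ => 0).

Lemma share_hnonneg k : hnonneg V k (share k).
Proof.
  apply (hnonneg_iter V E A mbar agent rcv) with (k := O); auto.
  split; simpl; intros; [|lra]. apply Rlt_le, Rinv_0_lt_compat, lt_0_INR; exact HV.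
Qed.

Lemma share_mass k : mass V k (share k) = 1.
Proof.
  transitivity (mass V 0 (fun _ => / INR V, fun _ _ => 0)).
  { apply (mass_iter V E A agent rcv) with (k := O); assumption. }
  unfold mass, hold; simpl.
  rewrite (rsum_ext V _ (fun _ => / INR V)) by (intros; ring).
  rewrite rsum_const. apply Rinv_r. apply not_0_INR; lia.
Qed.

(** Subtracting the right multiple of the mass-one trajectory leaves total mass zero, where the
    dynamics contract. *)
Definition z_error (k l : nat) : hstate := hlin 1 (z_state k l) (- grad_sum k l) (share k).

Lemma z_error_S k l : z_error (S k) l =
  hlin 1 (zstep k (z_error k l)) 1
         (hlin (grad_change k l) (split_inject E A agent k)
               (- grad_change k l) (share (S k))).
Proof.
  unfold z_error. rewrite z_state_S, grad_sum_S, split_step_lin.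
  change (share (S k)) with (zstep k (share k)).
  apply hstate_ext; intros; cbn [fst snd hlin]; ring.
Qed.

(** Both states are nonnegative of mass one, so their difference has mass zero and l1 norm at most
    2. *)
Lemma z_inject_balanced k l : balanced V (S k)
  (hlin (grad_change k l) (split_inject E A agent k) (- grad_change k l) (share (S k)))
  (2 * Rabs (grad_change k l)).
Proof.
  split.
  - rewrite mass_lin, (mass_inject V E A agent), share_mass by assumption. ring.
  - eapply Rle_trans; [apply mass_habs_lin|]. rewrite Rabs_Ropp.
    rewrite mass_habs_hnonneg by (apply (hnonneg_inject V E A mbar agent); assumption).
    rewrite mass_habs_hnonneg by apply share_hnonneg.
    rewrite (mass_inject V E A agent), share_mass by assumption. lra.
Qed.

(** * Envelopes of the consensus and tracking errors *)

Lemma W_le_1 i : (i < V)%nat -> W i i <= 1.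
Proof.
  intros Hi. rewrite <- (row_weights V E W) with (i := i) by assumption.
  enough (0 <= rsum V (fun j => if E j i then W i j else 0)) by lra.
  apply rsum_nonneg. intros j Hj. destruct (E j i) eqn:He; [|lra].
  pose proof (HWe i j Hi Hj He); lra.
Qed.

Lemma x_inject_range k :
  avg_low V D (S k) (x_inject k) 0 /\
  avg_low V D (S k) (hlin (-1) (x_inject k) 0 (x_inject k)) (-1).
Proof.
  pose proof (W_le_1 _ (Hagent k)). pose proof (HWd _ (Hagent k)).
  unfold x_inject; split; split; simpl fst; simpl snd; cbn [fst snd]; intros;
    destruct (Nat.eqb a (agent k)); try destruct (Nat.eqb t (S k)); simpl; lra.
Qed.

Lemma avg_spread_scaled k h r c : 0 <= r ->
  avg_low V D k h 0 -> avg_low V D k (hlin (-1) h 0 h) (- r) ->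
  avg_spread V D k (hlin c h 0 h) (Rabs c * r).
Proof.
  intros Hr [Hx Hv] [Hx' Hv']. simpl in Hx', Hv'.
  destruct (Rle_dec 0 c) as [Hc|Hc].
  - rewrite Rabs_pos_eq by exact Hc. exists 0. split; split; simpl; intros;
    [specialize (Hx a H) | specialize (Hv t a H H0)
    |specialize (Hx' a H) | specialize (Hv' t a H H0)]; nra.
  - rewrite Rabs_left1 by lra. exists (c * r). split; split; simpl; intros;
    [specialize (Hx' a H) | specialize (Hv' t a H H0)
    |specialize (Hx a H) | specialize (Hv t a H H0)]; nra.
Qed.

Definition x_move (k : nat) : R := gamma k * norm n (sz (run k) (agent k)).

Lemma x_move_nonneg k : 0 <= x_move k.
Proof. apply Rmult_le_pos; [apply Hgamma | apply norm_nonneg]. Qed.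

Lemma x_envelope : exists rho c r, 0 < rho < 1 /\ 0 < c /\ (forall k : nat, 0 <= r k) /\
  (forall k, r (S k) = rho * r k + c * x_move k) /\
  (forall k l, (l < n)%nat -> avg_spread V D k (x_state k l) (r k)).
Proof.
  destruct (avg_envelope V T D E W mbar agent src) as (rho & c & Hrho & Hc & Henv);
    auto using src_window.
  (* One bound for all agents and coordinates. The zero record also lies in [[-b, b]], so the
     initial spread is at most [2 * b]. *)
  set (b := rsum n (fun l => rsum V (fun a => Rabs (x0 a l)))).
  assert (Hb : forall l a, (l < n)%nat -> (a < V)%nat -> Rabs (x0 a l) <= b).
  { intros l a Hl Ha.
    apply Rle_trans with (rsum V (fun a => Rabs (x0 a l))).
    - apply (rsum_term_le V (fun a => Rabs (x0 a l))); auto. intros; apply Rabs_pos.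
    - apply (rsum_term_le n (fun l => rsum V (fun a => Rabs (x0 a l)))); auto.
      intros; apply rsum_nonneg; intros; apply Rabs_pos. }
  assert (Hb0 : 0 <= b).
  { apply rsum_nonneg; intros; apply rsum_nonneg; intros; apply Rabs_pos. }
  set (r := fix r k := match k with O => c * (2 * b)
                       | S k' => rho * r k' + c * x_move k' end).
  exists rho, c, r. split; [exact Hrho|]. split; [exact Hc|].
  pose proof x_move_nonneg as Hmove.
  split; [|split].
  - induction k as [|k IH]; simpl; [nra|]. specialize (Hmove k). nra.
  - reflexivity.
  - intros k l Hl.
    apply (Henv (fun k => x_state k l) (fun k =>
        hlin (- (gamma k * sz (run k) (agent k) l)) (x_inject k) 0 (x_inject k))
        (2 * b) x_move r); auto; [lra| | |].
    + exists (- b). unfold x_state; rewrite run_0. split; split; simpl; intros; unfold vzero.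
      1, 3: pose proof (Hb l a Hl H) as Hba; apply Rabs_le_inv in Hba; lra.
      all: lra.
    + intros k'. rewrite x_state_S. apply hstate_ext; intros; cbn [fst snd hlin]; ring.
    + intros k'. destruct (x_inject_range k') as [Hlo Hup].
      assert (Hs := avg_spread_scaled (S k') _ 1
                      (- (gamma k' * sz (run k') (agent k') l)) Rle_0_1 Hlo Hup).
      rewrite Rmult_1_r, Rabs_Ropp, Rabs_mult, (Rabs_pos_eq (gamma k')) in Hs by auto.
      destruct Hs as (m & Hs1 & [Hs2 Hs3]). exists m. split; [exact Hs1|].
      assert (gamma k' * Rabs (sz (run k') (agent k') l) <= x_move k').
      { apply Rmult_le_compat_l; [auto | apply coord_le_norm; exact Hl]. }
      split; intros; [specialize (Hs2 a H0) | specialize (Hs3 t a H0 H1)]; lra.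
Qed.

Lemma z_envelope : exists rho c q, 0 < rho < 1 /\ 0 < c /\ (forall k : nat, 0 <= q k) /\
  (forall k, q (S k) = rho * q k + c * (2 * norm n (grad_change k))) /\
  (forall k l, (l < n)%nat -> balanced V k (z_error k l) (q k)).
Proof.
  destruct (split_envelope V T D E A mbar agent rcv) as (rho & c & Hrho & Hc & Henv);
    auto using rcv_old.
  set (b := rsum n (fun l => mass V 0 (habs (z_error 0 l)))).
  assert (Hpos : forall l, 0 <= mass V 0 (habs (z_error 0 l))).
  { intros l. apply mass_hnonneg, habs_hnonneg. }
  assert (Hb0 : 0 <= b) by (apply rsum_nonneg; auto).
  set (q := fix q k := match k with O => c * b
                       | S k' => rho * q k' + c * (2 * norm n (grad_change k')) end).
  exists rho, c, q. split; [exact Hrho|]. split; [exact Hc|]. split; [|split].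
  - induction k as [|k IH]; simpl; [nra|]. pose proof (norm_nonneg n (grad_change k)). nra.
  - reflexivity.
  - intros k l Hl.
    apply (Henv (fun k => z_error k l) (fun k =>
        hlin (grad_change k l) (split_inject E A agent k)
             (- grad_change k l) (share (S k)))
        b (fun k => 2 * norm n (grad_change k)) q); auto.
    + split.
      * unfold z_error. rewrite mass_lin, mass_z_state, share_mass. ring.
      * apply (rsum_term_le n (fun l => mass V 0 (habs (z_error 0 l)))); auto.
    + intros k'. pose proof (norm_nonneg n (grad_change k')); lra.
    + intros k'. apply z_error_S.
    + intros k'. destruct (z_inject_balanced k' l) as [H0 Hle]. split; [exact H0|].
      pose proof (coord_le_norm n (grad_change k') l Hl). lra.
Qed.

(** * Descent of the objective *)

Definition Lsum : R := rsum V (fun i => Rabs (L i)).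
Definition objective (x : vec) : R := rsum V (fun i => f i x).
Definition gradient (x : vec) : vec := vsum V (fun i => g i x).

Lemma Lsum_nonneg : 0 <= Lsum.
Proof. apply rsum_nonneg; intros; apply Rabs_pos. Qed.

Lemma L_le_Lsum i : (i < V)%nat -> Rabs (L i) <= Lsum.
Proof.
  intros Hi. apply (rsum_term_le V (fun i => Rabs (L i))); auto. intros; apply Rabs_pos.
Qed.

Lemma gradients_close (u : nat -> vec) y r :
  (forall i, (i < V)%nat -> norm n (vsub (u i) y) <= r) ->
  norm n (vsub (vsum V (fun i => g i (u i))) (gradient y)) <= Lsum * r.
Proof.
  intros Hu.
  rewrite (norm_ext n _ (vsum V (fun i => vsub (g i (u i)) (g i y)))).
  - eapply Rle_trans; [apply norm_vsum|]. unfold Lsum.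
    rewrite Rmult_comm, <- rsum_scal. apply rsum_le. intros i Hi.
    eapply Rle_trans; [apply HLip; exact Hi|].
    specialize (Hu i Hi). pose proof (norm_nonneg n (vsub (u i) y)).
    pose proof (Rle_abs (L i)). pose proof (Rabs_pos (L i)).
    apply Rle_trans with (Rabs (L i) * norm n (vsub (u i) y)).
    + apply Rmult_le_compat_r; assumption.
    + rewrite Rmult_comm. apply Rmult_le_compat_r; assumption.
  - intros l _. unfold gradient, vsub, vsum. rewrite rsum_minus. reflexivity.
Qed.

Lemma objective_descent y h :
  objective (vadd y h) <= objective y + inner n (gradient y) h + Lsum * sqnorm n h.
Proof.
  unfold objective, gradient, Lsum. rewrite inner_vsum_l.
  rewrite (Rmult_comm _ (sqnorm n h)), <- rsum_scal, <- !rsum_plus.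
  apply rsum_le. intros i Hi. rewrite (Rmult_comm (sqnorm n h)).
  apply descent_inequality; auto.
Qed.

(* The value on which all agents would (nearly) agree at the horizon [K] if the step
   sizes vanished from time [k] on: a convex combination of the information at time [k]. *)
Definition center (K k : nat) : vec :=
  fun l => fst (evolve xstep k (K - k) (x_state k l)) O.

Definition center_weight (K k : nat) : R :=
  fst (evolve xstep (S k) (K - S k) (x_inject k)) O.

Lemma center_S K k : (k < K)%nat -> center K (S k) =
  vadd (center K k) (vscale (- (gamma k * center_weight K k)) (direction k)).
Proof.
  intros HkK. apply functional_extensionality; intros l.
  unfold center, center_weight, vadd, vscale.
  rewrite x_state_S, evolve_hlin by (intros; apply avg_step_lin).
  replace (K - k)%nat with (S (K - S k)) by lia. rewrite evolve_S_front.
  cbn [fst snd hlin]. ring.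
Qed.

Lemma avg_low_run k s h m : avg_low V D k h m -> avg_low V D (k + s) (evolve xstep k s h) m.
Proof.
  apply (avg_low_iter V D E W mbar); auto. intros; apply src_window; auto.
Qed.

(** Averaging preserves the range [[0, 1]] of the injected state. With more than [N] steps left,
    positivity spreads the active agent's entry [W i i >= mbar] to all agents, and this lower bound
    then persists up to the horizon. *)
Lemma center_weight_range : exists eta N, 0 < eta /\
  forall K k, (k + N < K)%nat -> eta <= center_weight K k <= 1.
Proof.
  destruct (avg_positivity V T D E W mbar agent src)
    as (N & _ & HN); auto.
  { intros; apply src_window; auto. }
  exists (mbar ^ N * mbar), N. split; [apply Rmult_lt_0_compat; [apply pow_lt|]; lra|].
  intros K k HK.
  destruct (x_inject_range k) as [Hlo Hup].
  unfold center_weight. split.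
  - specialize (HN (S k) (x_inject k) (agent k) (Hagent k) Hlo).
    replace (K - S k)%nat with (N + (K - S k - N))%nat by lia. rewrite evolve_add.
    apply (avg_low_run _ (K - S k - N)) in HN. destruct HN as [HN _].
    eapply Rle_trans; [|apply HN; exact HV]. simpl. rewrite Nat.eqb_refl.
    apply Rmult_le_compat_l; [apply pow_le; lra | apply HWd; auto].
  - apply (avg_low_run _ (K - S k)) in Hup. destruct Hup as [Hup _].
    rewrite evolve_hlin in Hup by (intros; apply avg_step_lin).
    specialize (Hup O HV). cbn [fst hlin] in Hup. lra.
Qed.

(** All these points are convex combinations of window values and so share one interval; only the
    new iterate leaves it, by at most the size of the current move. *)
Lemma avg_spread_facts K k l r : avg_spread V D k (x_state k l) r -> exists m,
  (forall a, (a < V)%nat -> m <= sx (run k) a l <= m + r) /\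
  m <= center K k l <= m + r /\
  m <= xbar V (sx (run k)) l <= m + r /\
  m - gamma k * Rabs (direction k l) <= xnew k l <= m + r + gamma k * Rabs (direction k l).
Proof.
  intros (m & Hlo & Hup). exists m.
  assert (Hx : forall a, (a < V)%nat -> m <= sx (run k) a l <= m + r).
  { intros a Ha. destruct Hlo as [Hlo _]. destruct Hup as [Hup _].
    specialize (Hlo a Ha). specialize (Hup a Ha). simpl in Hlo, Hup. lra. }
  split; [exact Hx|]. split; [|split].
  - apply (avg_low_run _ (K - k)) in Hlo. apply (avg_low_run _ (K - k)) in Hup.
    rewrite evolve_hlin in Hup by (intros; apply avg_step_lin).
    destruct Hlo as [Hlo _]. destruct Hup as [Hup _].
    specialize (Hlo O HV). specialize (Hup O HV). cbn [fst hlin] in Hup.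
    unfold center. lra.
  - unfold xbar, vscale, vsum.
    assert (HVp : 0 < INR V) by (apply lt_0_INR; exact HV).
    assert (INR V * m <= rsum V (fun j => sx (run k) j l))
      by (rewrite <- rsum_const; apply rsum_le; intros; apply Hx; assumption).
    assert (rsum V (fun j => sx (run k) j l) <= INR V * (m + r))
      by (rewrite <- rsum_const; apply rsum_le; intros; apply Hx; assumption).
    split; (apply Rmult_le_reg_l with (INR V); [exact HVp|];
            rewrite <- Rmult_assoc, Rinv_r, Rmult_1_l by lra; assumption).
  - apply (avg_low_run _ 1) in Hlo. apply (avg_low_run _ 1) in Hup.
    rewrite evolve_hlin in Hup by (intros; apply avg_step_lin).
    change (evolve xstep k 1 (x_state k l)) with (xstep (k + 0)%nat (x_state k l)) in *.
    rewrite Nat.add_0_r in *.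
    destruct Hlo as [Hlo _]. destruct Hup as [Hup _].
    specialize (Hlo _ (Hagent k)). specialize (Hup _ (Hagent k)). cbn [fst hlin] in Hup.
    assert (Hnew : xnew k l = fst (x_state (S k) l) (agent k)) by reflexivity.
    rewrite Hnew, x_state_S. unfold x_inject. cbn [fst hlin]. rewrite Nat.eqb_refl.
    assert (Hw : 0 <= W (agent k) (agent k) <= 1).
    { split; [pose proof (HWd _ (Hagent k)); lra|].
      apply W_le_1; auto. }
    assert (Hgz : Rabs (gamma k * direction k l * W (agent k) (agent k))
                  <= gamma k * Rabs (direction k l)).
    { rewrite !Rabs_mult, (Rabs_pos_eq (gamma k)), (Rabs_pos_eq (W _ _)) by (auto; lra).
      rewrite <- (Rmult_1_r (gamma k * Rabs (direction k l))) at 2.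
      apply Rmult_le_compat_l; [|lra].
      apply Rmult_le_pos; [auto | apply Rabs_pos]. }
    apply Rabs_le_inv in Hgz. lra.
Qed.

(** The lower bound is positivity applied to the trajectory [N] steps earlier, whose mass is one;
    the upper bound is the total mass. *)
Lemma share_range : exists eta N, 0 < eta /\ forall k i, (i < V)%nat -> (N <= k)%nat ->
  eta <= fst (share k) i <= 1.
Proof.
  destruct (split_positivity V T D E A mbar agent rcv)
    as (N & eta & _ & Heta & HN); auto.
  { intros; apply rcv_old; auto. }
  exists eta, N. split; [lra|]. intros k i Hi HNk.
  assert (Hnn : forall k, hnonneg V k (share k))
    by (intros; apply share_hnonneg).
  assert (Hmass : forall k, mass V k (share k) = 1)
    by (intros; apply share_mass).
  split.
  - specialize (HN (k - N)%nat (share (k - N)) i Hi (Hnn _)).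
    rewrite Hmass, Rmult_1_r in HN. unfold share in *.
    change (k - N)%nat with (0 + (k - N))%nat in HN at 1.
    rewrite <- evolve_add in HN. replace (k - N + N)%nat with k in HN by lia. exact HN.
  - eapply Rle_trans; [apply Rle_abs|].
    eapply Rle_trans; [apply (fst_le_mass_habs V k); exact Hi|].
    rewrite mass_habs_hnonneg, Hmass by auto. lra.
Qed.

Lemma direction_close k y q r eta : 0 <= q -> 0 <= r ->
  eta <= fst (share k) (agent k) <= 1 ->
  (forall l, (l < n)%nat -> balanced V k (z_error k l) q) ->
  norm n (vsub (grad_sum k) (gradient y)) <= r ->
  0 <= eta ->
  norm n (direction k) <= norm n (gradient y) + (r + sqrt (INR n) * q) /\
  eta * (norm n (gradient y) * norm n (gradient y))
    - norm n (gradient y) * (r + sqrt (INR n) * q)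
  <= inner n (gradient y) (direction k).
Proof.
  intros Hq Hr Hxi Hbal Hclose Heta. set (xi := fst (share k) (agent k)) in *.
  (* The direction is [xi] times the gradient at [y] plus [w], which collects the tracking error and
     the consensus error; the latter is not enlarged since [xi <= 1]. *)
  set (w := vadd (vsub (direction k) (vscale xi (grad_sum k)))
                 (vscale xi (vsub (grad_sum k) (gradient y)))).
  assert (Hw : norm n w <= r + sqrt (INR n) * q).
  { eapply Rle_trans; [apply norm_vadd|]. rewrite norm_vscale, Rabs_pos_eq by lra.
    assert (norm n (vsub (direction k) (vscale xi (grad_sum k))) <= sqrt (INR n) * q).
    { apply norm_le_coords; [exact Hq|]. intros l Hl. destruct (Hbal l Hl) as [_ Hb].
      eapply Rle_trans; [|exact Hb].
      pose proof (fst_le_mass_habs V k (z_error k l) (agent k) (Hagent k)) as Hz.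
      unfold z_error in Hz at 1. cbn [fst hlin z_state] in Hz. fold xi in Hz.
      unfold vsub, vscale.
      replace (direction k l - xi * grad_sum k l) with
        (1 * direction k l + - grad_sum k l * xi) by ring. exact Hz. }
    pose proof (norm_nonneg n (vsub (grad_sum k) (gradient y))). nra. }
  assert (Hdir : direction k = vadd (vscale xi (gradient y)) (vscale 1 w)).
  { apply functional_extensionality; intros l. unfold w, vadd, vsub, vscale. ring. }
  pose proof (norm_nonneg n (gradient y)) as HG. rewrite Hdir. split.
  - eapply Rle_trans; [apply norm_vadd|].
    rewrite !norm_vscale, Rabs_R1, Rabs_pos_eq by lra. nra.
  - rewrite inner_lin_r. change (inner n (gradient y) (gradient y)) with
      (sqnorm n (gradient y)). rewrite <- norm_sqr.
    pose proof (cauchy_schwarz n (gradient y) w) as Hcs. apply Rabs_le_inv in Hcs.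
    assert (norm n (gradient y) * norm n w
            <= norm n (gradient y) * (r + sqrt (INR n) * q))
      by (apply Rmult_le_compat_l; assumption).
    nra.
Qed.

Lemma weighted_merit_summable : exists C, forall K,
  rsum K (fun k => gamma k * merit n V g (sx (run k))) <= C.
Proof.
  destruct x_envelope as (rho1 & c1 & r & Hrho1 & Hc1 & Hr0 & HrS & Hspread).
  destruct z_envelope as (rho2 & c2 & q & Hrho2 & Hc2 & Hq0 & HqS & Hbal).
  destruct center_weight_range as (eta1 & N1 & Heta1 & Hweight).
  destruct share_range as (eta2 & N2 & Heta2 & Hshare).
  pose proof Lsum_nonneg as HL.
  set (sn := sqrt (INR n)). assert (Hsn : 0 <= sn) by apply sqrt_pos.
  assert (HC3 : 0 <= Lsum * sn) by (apply Rmult_le_pos; assumption).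
  destruct (lyapunov_decrease rho1 c1 rho2 c2 eta1 eta2 Lsum (Lsum * sn) sn (Lsum * sn))
    as (a & cc & Gam & Ha & Hcc & HGam & Hlyap); auto.
  destruct (Hgamma_small Gam ltac:(lra)) as (k1 & Hk1).
  (* From [k0] on, step sizes are below [Gam] and all shares are bounded away from zero. *)
  set (k0 := (k1 + N2)%nat).
  set (G := fun K k => norm n (gradient (center K k))).
  set (Phi := fun K k => objective (center K k) + a * (r k * r k) + q k * q k).
  assert (Hnear : forall K k i, (i < V)%nat ->
            norm n (vsub (sx (run k) i) (center K k)) <= sn * r k).
  { intros K k i Hi. apply norm_le_coords; [auto|]. intros l Hl.
    destruct (avg_spread_facts K k l _ (Hspread k l Hl)) as (m & Hx & Hc & _).
    specialize (Hx i Hi). unfold vsub. apply Rabs_le. lra. }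
  assert (Hstep : forall K k, (k0 <= k)%nat -> (k + N1 < K)%nat ->
     Phi K (S k) <= Phi K k - cc * (gamma k * (G K k * G K k) + r k * r k)).
  { intros K k Hk HK. unfold Phi. rewrite HrS, HqS. unfold x_move.
    set (y := center K k). set (Z := norm n (direction k)).
    assert (HZ0 : 0 <= Z) by apply norm_nonneg.
    pose proof (Hweight K k HK) as Hb.
    destruct (direction_close k y (q k) (Lsum * sn * r k) eta2) as [HZ Hip]; auto.
    - apply Rmult_le_pos; auto.
    - apply Hshare; auto. unfold k0 in Hk; lia.
    - rewrite Rmult_assoc. apply (gradients_close (sx (run k))). intros; apply Hnear; auto.
    - lra.
    - apply (Hlyap (gamma k) (center_weight K k) (G K k) Z (r k) (q k)
                   (norm n (grad_change k)) (inner n (gradient y) (direction k))); auto.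
      + split; [auto|]. apply Hk1. unfold k0 in Hk; lia.
      + apply norm_nonneg.
      + apply norm_nonneg.
      + unfold grad_change.
        eapply Rle_trans; [apply HLip; apply Hagent|].
        pose proof (norm_nonneg n (vsub (xnew k) (sx (run k) (agent k)))) as Hn0.
        apply Rle_trans with (Lsum * norm n (vsub (xnew k) (sx (run k) (agent k)))).
        * apply Rmult_le_compat_r; [exact Hn0|].
          eapply Rle_trans; [apply Rle_abs | apply L_le_Lsum; auto].
        * rewrite Rmult_assoc. apply Rmult_le_compat_l; [exact HL|].
          assert (Hgz : 0 <= gamma k * Z) by (apply Rmult_le_pos; auto).
          apply norm_le_coords; [pose proof (Hr0 k); lra|]. intros l Hl.
          destruct (avg_spread_facts K k l _ (Hspread k l Hl)) as (m & Hx & _ & _ & Hxn).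
          specialize (Hx _ (Hagent k)).
          assert (gamma k * Rabs (direction k l) <= gamma k * Z)
            by (apply Rmult_le_compat_l; [auto | apply coord_le_norm; exact Hl]).
          unfold vsub. apply Rabs_le. lra.
      + rewrite center_S by lia. fold y.
        eapply Rle_trans; [apply objective_descent|].
        set (b := center_weight K k) in *.
        replace (inner n (gradient y) (vscale (- (gamma k * b)) (direction k)))
          with (- (gamma k * b * inner n (gradient y) (direction k))).
        2:{ unfold inner, vscale. rewrite <- rsum_scal.
            rewrite <- (Rmult_1_l (rsum n (fun i => gamma k * b * _))), Ropp_mult_distr_l,
              <- rsum_scal.
            apply rsum_ext. intros; ring. }
        rewrite <- norm_sqr, norm_vscale, Rabs_Ropp, Rabs_pos_eq
          by (apply Rmult_le_pos; [auto | lra]). fold Z.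
        assert (gamma k * b * Z * (gamma k * b * Z) <= gamma k * Z * (gamma k * Z)).
        { assert (gamma k * b * Z <= gamma k * Z).
          { rewrite (Rmult_comm (gamma k) b), Rmult_assoc.
            rewrite <- (Rmult_1_l (gamma k * Z)) at 2.
            apply Rmult_le_compat_r; [apply Rmult_le_pos; auto | lra]. }
          assert (0 <= gamma k * b * Z)
            by (apply Rmult_le_pos; [apply Rmult_le_pos|]; auto; lra).
          apply Rmult_le_compat; auto. }
        assert (Lsum * (gamma k * b * Z * (gamma k * b * Z))
                <= Lsum * (gamma k * Z * (gamma k * Z)))
          by (apply Rmult_le_compat_l; assumption).
        lra. }
  destruct Hbnd as [lb Hlb].
  set (y0 := sx (run k0) O).
  (* The center depends on the horizon [K], but at time [k0] it lies within [sn * r k0] of the fixed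
     point [y0]; descent from [y0] bounds the initial Lyapunov value uniformly in [K]. *)
  set (Cs := objective y0 + norm n (gradient y0) * (sn * r k0)
             + Lsum * (sn * r k0 * (sn * r k0)) + a * (r k0 * r k0) + q k0 * q k0).
  assert (Hstart : forall K, Phi K k0 <= Cs).
  { intros K. unfold Phi, Cs.
    set (h := vsub (center K k0) y0).
    replace (center K k0) with (vadd y0 h)
      by (apply functional_extensionality; intros l; unfold h, vadd, vsub; ring).
    assert (Hh : norm n h <= sn * r k0).
    { rewrite (norm_ext n h (vscale (-1) (vsub y0 (center K k0))))
        by (intros; unfold h, vscale, vsub; ring).
      rewrite norm_vscale, Rabs_left1 by lra.
      pose proof (Hnear K k0 O HV). unfold y0. lra. }
    pose proof (objective_descent y0 h) as Hd0.
    pose proof (inner_le n (gradient y0) h) as Hi. pose proof (norm_nonneg n h).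
    assert (norm n (gradient y0) * norm n h <= norm n (gradient y0) * (sn * r k0))
      by (apply Rmult_le_compat_l; [apply norm_nonneg | assumption]).
    assert (Lsum * sqnorm n h <= Lsum * (sn * r k0 * (sn * r k0))).
    { apply Rmult_le_compat_l; [exact HL|]. rewrite <- norm_sqr.
      apply Rmult_le_compat; assumption. }
    lra. }
  (* The first two terms come from squaring the bound [G + Lsum * sn * r] on the gradient at the
     mean, the last from summing the spread over agents and coordinates. *)
  set (Cm := 2 + 2 * (Lsum * sn * (Lsum * sn)) + INR V * INR n).
  assert (HCm : 2 <= Cm).
  { unfold Cm. pose proof (pos_INR V). pose proof (pos_INR n). nra. }
  assert (Hmerit : forall K k, merit n V g (sx (run k)) <= Cm * (G K k * G K k + r k * r k)).
  { intros K k. unfold merit. pose proof (Hr0 k) as Hrk.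
    assert (HGG : 0 <= G K k * G K k) by apply Rle_0_sqr.
    assert (Hrr : 0 <= r k * r k) by apply Rle_0_sqr.
    assert (HLL : 0 <= Lsum * sn * (Lsum * sn)) by apply Rle_0_sqr.
    assert (HVn : 0 <= INR V * INR n) by (apply Rmult_le_pos; apply pos_INR).
    assert (0 <= Lsum * sn * (Lsum * sn) * (G K k * G K k)) by (apply Rmult_le_pos; lra).
    assert (0 <= Lsum * sn * (Lsum * sn) * (r k * r k)) by (apply Rmult_le_pos; lra).
    assert (0 <= INR V * INR n * (G K k * G K k)) by (apply Rmult_le_pos; lra).
    assert (0 <= INR V * INR n * (r k * r k)) by (apply Rmult_le_pos; lra).
    apply Rmax_lub.
    - set (xb := xbar V (sx (run k))). change (vsum V (fun i => g i xb)) with (gradient xb).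
      assert (Hxb : norm n (vsub xb (center K k)) <= sn * r k).
      { apply norm_le_coords; [auto|]. intros l Hl.
        destruct (avg_spread_facts K k l _ (Hspread k l Hl)) as (m & _ & Hc & Hxb & _).
        unfold vsub. apply Rabs_le. unfold xb. lra. }
      assert (Hgb : norm n (gradient xb) <= G K k + Lsum * sn * r k).
      { rewrite Rmult_assoc.
        pose proof (gradients_close (fun _ => xb) (center K k) _ (fun _ _ => Hxb)) as Hgc.
        rewrite (norm_ext n (gradient xb) (vadd (gradient (center K k))
           (vsub (vsum V (fun i => g i xb)) (gradient (center K k)))))
          by (intros; unfold vadd, vsub, gradient; ring).
        eapply Rle_trans; [apply norm_vadd|]. unfold G. lra. }
      pose proof (norm_nonneg n (gradient xb)).
      rewrite <- norm_sqr.
      eapply Rle_trans; [apply Rmult_le_compat; eassumption|].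
      eapply Rle_trans; [apply sqr_add_le|]. unfold Cm. lra.
    - apply Rle_trans with (INR V * (INR n * (r k * r k))); [|unfold Cm; lra].
      rewrite <- rsum_const. apply rsum_le. intros i Hi.
      apply sqnorm_le_coords. intros l Hl.
      destruct (avg_spread_facts K k l _ (Hspread k l Hl)) as (m & Hx & _ & Hxb & _).
      specialize (Hx i Hi). unfold vsub. apply Rabs_le. lra. }
  assert (Hmpos : forall k, 0 <= gamma k * merit n V g (sx (run k))).
  { intros k. apply Rmult_le_pos; [auto|].
    eapply Rle_trans; [apply sqnorm_nonneg | apply Rmax_l]. }
  assert (Htail : forall m,
    rsum m (fun t => gamma (k0 + t)%nat * merit n V g (sx (run (k0 + t))))
    <= Cm / cc * (Cs - lb)).
  { intros m. set (K := (k0 + m + N1 + 1)%nat).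
    assert (Htel : forall j, (j <= m)%nat ->
      rsum j (fun t => gamma (k0 + t)%nat * merit n V g (sx (run (k0 + t))))
      + Cm / cc * Phi K (k0 + j)%nat <= Cm / cc * Phi K k0).
    { induction j as [|j IH]; intros Hj; [simpl; rewrite Nat.add_0_r; lra|].
      specialize (IH ltac:(lia)). simpl rsum. rewrite Nat.add_succ_r.
      pose proof (Hstep K (k0 + j)%nat ltac:(lia) ltac:(unfold K; lia)) as Hs.
      assert (Hgm : gamma (k0 + j)%nat * merit n V g (sx (run (k0 + j)))
        <= Cm * (gamma (k0 + j)%nat * (G K (k0 + j)%nat * G K (k0 + j)%nat)
                 + r (k0 + j)%nat * r (k0 + j)%nat)).
      { set (k := (k0 + j)%nat).
        assert (Hgk : 0 <= gamma k <= 1).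
        { split; [auto|]. apply Rle_trans with Gam; [|lra]. apply Hk1. unfold k, k0; lia. }
        apply Rle_trans with (gamma k * (Cm * (G K k * G K k + r k * r k)));
          [apply Rmult_le_compat_l; [lra | apply Hmerit]|].
        assert (0 <= Cm * (1 - gamma k) * (r k * r k))
          by (apply Rmult_le_pos; [apply Rmult_le_pos; lra | apply Rle_0_sqr]).
        lra. }
      assert (Hc : 0 <= Cm / cc) by (apply Rlt_le, Rdiv_lt_0_compat; lra).
      apply (Rmult_le_compat_l (Cm / cc) _ _ Hc) in Hs.
      rewrite Rmult_minus_distr_l in Hs.
      replace (Cm / cc * (cc * (gamma (k0 + j)%nat * (G K (k0 + j)%nat * G K (k0 + j)%nat)
                 + r (k0 + j)%nat * r (k0 + j)%nat))) with
        (Cm * (gamma (k0 + j)%nat * (G K (k0 + j)%nat * G K (k0 + j)%nat)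
                 + r (k0 + j)%nat * r (k0 + j)%nat)) in Hs by (field; lra).
      lra. }
    specialize (Htel m (Nat.le_refl m)). pose proof (Hstart K) as HsK.
    assert (HlbK : lb <= Phi K (k0 + m)%nat).
    { unfold Phi. pose proof (Hlb (center K (k0 + m))) as Hl.
      change (rsum V (fun i => f i (center K (k0 + m))))
        with (objective (center K (k0 + m))) in Hl.
      assert (0 <= a * (r (k0 + m)%nat * r (k0 + m)%nat))
        by (apply Rmult_le_pos; [exact Ha | apply Rle_0_sqr]).
      pose proof (Rle_0_sqr (q (k0 + m)%nat)) as Hq. unfold Rsqr in Hq. lra. }
    assert (Hc : 0 <= Cm / cc) by (apply Rlt_le, Rdiv_lt_0_compat; lra).
    apply (Rmult_le_compat_l (Cm / cc) _ _ Hc) in HsK.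
    apply (Rmult_le_compat_l (Cm / cc) _ _ Hc) in HlbK. lra. }
  set (term := fun k => gamma k * merit n V g (sx (run k))) in *.
  exists (rsum k0 term + Cm / cc * (Cs - lb)). intros K.
  apply Rle_trans with (rsum (k0 + K) term).
  - rewrite Nat.add_comm, rsum_split.
    pose proof (rsum_nonneg k0 (fun i => term (K + i)%nat) (fun _ _ => Hmpos _)). lra.
  - rewrite rsum_split. specialize (Htail K). unfold term in *. lra.
Qed.

End Algorithm.

(** * Step sizes and complexity *)

(** Every block of [T] iterations contributes one activation of each agent. Hence all local counters
    tend to infinity and the global step sizes to zero. *)
Lemma act_count_lower agent V T :
  (forall k i, (i < V)%nat -> exists t, (k <= t < k + T)%nat /\ agent t = i) ->
  forall N k i, (i < V)%nat -> (N * T <= k)%nat -> (N <= act_count agent k i)%nat.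
Proof.
  intros HT.
  assert (Hmono : forall k m i, (act_count agent k i <= act_count agent (k + m) i)%nat).
  { intros k m i. induction m as [|m IH]; [rewrite Nat.add_0_r; lia|].
    rewrite Nat.add_succ_r. simpl. lia. }
  intros N. induction N as [|N IH]; intros k i Hi Hk; [lia|].
  destruct (HT (N * T)%nat i Hi) as (t & Ht & Hat).
  specialize (IH t i Hi ltac:(lia)).
  pose proof (Hmono (S t) (k - S t)%nat i) as Hm.
  replace (S t + (k - S t))%nat with k in Hm by lia.
  simpl in Hm. rewrite Hat, Nat.eqb_refl in Hm. lia.
Qed.

(** The bound on the hitting time is expressed without infima: any [K] whose partial sum, including
    the term [K], reaches [c / delta] has an iteration with merit at most [delta] no later than
    itself. *)
Theorem theorem4
  (n I : nat) (f : nat -> vec -> R) (g : nat -> vec -> vec) (L : nat -> R)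
  (E : nat -> nat -> bool) (W A : nat -> nat -> R) (mbar : R)
  (agent : nat -> nat) (d : nat -> nat -> nat) (T D : nat)
  (alpha : nat -> R) (x0 : nat -> vec)
  (* problem *)
  (HI : (0 < I)%nat)
  (Hgrad : forall i, (i < I)%nat -> is_gradient n (f i) (g i))
  (HLip : forall i, (i < I)%nat -> forall x y,
            norm n (vsub (g i x) (g i y)) <= L i * norm n (vsub x y))
  (Hbnd : exists lb, forall x, lb <= rsum I (fun i => f i x))
  (* graph *)
  (HEV : forall i j, E i j = true -> (i < I)%nat /\ (j < I)%nat)
  (HEloop : forall i, E i i = false)
  (HEconn : forall i j, (i < I)%nat -> (j < I)%nat ->
            clos_refl_trans nat (fun a b => E a b = true) i j)
  (* weights *)
  (Hm : 0 < mbar < 1)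
  (HWd : forall i, (i < I)%nat -> mbar <= W i i)
  (HWe : forall i j, (i < I)%nat -> (j < I)%nat -> E j i = true -> mbar <= W i j)
  (HW0 : forall i j, (i < I)%nat -> (j < I)%nat -> i <> j -> E j i = false -> W i j = 0)
  (HWrow : forall i, (i < I)%nat -> rsum I (fun j => W i j) = 1)
  (HAd : forall i, (i < I)%nat -> mbar <= A i i)
  (HAe : forall i j, (i < I)%nat -> (j < I)%nat -> E j i = true -> mbar <= A i j)
  (HA0 : forall i j, (i < I)%nat -> (j < I)%nat -> i <> j -> E j i = false -> A i j = 0)
  (HAcol : forall j, (j < I)%nat -> rsum I (fun i => A i j) = 1)
  (* asynchrony *)
  (Hagent : forall k, (agent k < I)%nat)
  (HT : forall k i, (i < I)%nat ->
        exists t, (k <= t < k + T)%nat /\ agent t = i)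
  (Hd : forall k j, E j (agent k) = true -> (d k j <= D)%nat)
  (* step sizes *)
  (Halpha_dec : forall t, alpha (S t) <= alpha t)
  (Halpha_lim : Un_cv alpha 0)
  (Halpha_div : forall M, exists N, M <= rsum N alpha) :
  let gamma := step_size alpha agent in
  let xk := fun k => sx (asy_run I E W A g agent d gamma D x0 k) in
  exists c, 0 < c /\
    forall delta, 0 < delta ->
      forall K, c / delta <= rsum (S K) gamma ->
        exists k, (k <= K)%nat /\ merit n I g (xk k) <= delta.
Proof.
  intros gamma xk.
  assert (Hdec : forall t s, (t <= s)%nat -> alpha s <= alpha t).
  { intros t s Hts. induction Hts as [|s Hts IH]; [lra|]. specialize (Halpha_dec s). lra. }
  assert (Hpos : forall t, 0 <= alpha t)
    by (intros t; apply (decreasing_ineq alpha 0); assumption).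
  assert (Hsmall : forall eps, 0 < eps ->
            exists k0, forall k, (k0 <= k)%nat -> gamma k <= eps).
  { intros eps Heps. destruct (Halpha_lim eps Heps) as [N HN].
    exists (N * T)%nat. intros k Hk. unfold gamma, step_size.
    pose proof (act_count_lower agent I T HT N k (agent k) (Hagent k) Hk) as Hc.
    eapply Rle_trans; [apply (Hdec N); exact Hc|].
    specialize (HN N (Nat.le_refl N)). unfold Rdist in HN.
    rewrite Rminus_0_r, Rabs_pos_eq in HN by auto. lra. }
  destruct (weighted_merit_summable n I T D E W A f g L agent d gamma x0 mbar) as [C HC];
    auto; [intros k; apply Hpos|].
  (* Strictly above the weighted merit bound: if the merit exceeded [delta] up to [K], the weighted
     sum would be at least [Rabs C + 1], contradicting its bound [C]. *)
  exists (Rabs C + 1). split; [pose proof (Rabs_pos C); lra|].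
  intros delta Hdelta K HK.
  apply NNPP. intros Hno.
  assert (Hbig : forall k, (k <= K)%nat -> delta < merit n I g (xk k)).
  { intros k Hk. apply Rnot_le_lt. intros Hle. apply Hno. exists k; auto. }
  assert (Hlow : delta * rsum (S K) gamma
                 <= rsum (S K) (fun k => gamma k * merit n I g (xk k))).
  { rewrite <- rsum_scal. apply rsum_le. intros k Hk. rewrite Rmult_comm.
    apply Rmult_le_compat_l; [apply Hpos|]. apply Rlt_le, Hbig; lia. }
  assert (Hc : Rabs C + 1 <= delta * rsum (S K) gamma).
  { apply (Rmult_le_compat_l delta) in HK; [|lra].
    replace (delta * ((Rabs C + 1) / delta)) with (Rabs C + 1) in HK by (field; lra).
    exact HK. }
  specialize (HC (S K)). pose proof (Rle_abs C).
  unfold run in HC. unfold xk in Hlow. lra.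
Qed.
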